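(* Let $M$ be an open connected subset of $\mathbb{R}^4$ on which the standard coordinates satisfy $x^1,x^2,x^3,x^4>0$, endowed with the Lorentzian metric $$g = e^{x^1+x^3}(dx^1)^2 + 2\,dx^1dx^2 + (dx^3)^2 + e^{x^1}(dx^4)^2 .$$ Then $(M,g)$: (i) is Ricci simple, and hence special quasi-Einstein; (ii) is a manifold of constant scalar curvature; (iii) is Ricci recurrent, and hence weakly Ricci symmetric, and its Ricci 1-forms are recurrent; (iv) is conharmonically recurrent, and hence conformally recurrent, as well as conharmonically weakly symmetric and conformally weakly symmetric, and the curvature 2-forms for $C$ and for $K$ are recurrent; (v) is hyper-generalized recurrent, and hence generalized Ricci recurrent; (vi) is semisymmetric ($R\cdot R=0$), and hence fulfills the semisymmetry conditions for $S$, $C$, $P$, $W$ and $K$, that is, $R\cdot S=0$, $R\cdot C=0$, $R\cdot P=0$, $R\cdot W=0$ and $R\cdot K=0$; (vii) is weakly Ricci symmetric and conharmonically weakly symmetric such that all the associated 1-forms are different (this proves the non-uniqueness of the associated 1-forms of weak symmetry structures); (viii) has recurrent curvature 2-forms (for $R$); (ix) fulfills the condition $P\cdot P=-\frac13 Q(S,P)$, i.e., has Ricci generalized pseudosymmetric Weyl projective curvature tensor.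
   Context: Here $n=\dim M=4$, $\nabla$ is the Levi-Civita connection, $\mathscr{R}(X,Y)=[\nabla_X,\nabla_Y]-\nabla_{[X,Y]}$, $R(X_1,X_2,X_3,X_4)=g(\mathscr{R}(X_1,X_2)X_3,X_4)$, $S$ is the Ricci tensor (the trace of $R$ over the first and fourth arguments, $S(X_2,X_3)$), and $r$ is the scalar curvature. All identities are for all vector fields. The metric convention $2\,dx^1dx^2$ means $g_{12}=g_{21}=1$. Kulkarni-Nomizu product of $(0,2)$-tensors: $(J\wedge F)(X_1,X_2,X_3,X_4)=J(X_1,X_4)F(X_2,X_3)+J(X_2,X_3)F(X_1,X_4)-J(X_1,X_3)F(X_2,X_4)-J(X_2,X_4)F(X_1,X_3)$. Conformal curvature tensor: $C=R-\frac{1}{n-2}(g\wedge S)+\frac{r}{2(n-1)(n-2)}(g\wedge g)$. Projective: $P(X_1,X_2,X_3,X_4)=R(X_1,X_2,X_3,X_4)-\frac{1}{n-1}[g(X_1,X_4)S(X_2,X_3)-g(X_2,X_4)S(X_1,X_3)]$. Concircular: $W=R-\frac{r}{2n(n-1)}(g\wedge g)$. Conharmonic: $K=R-\frac{1}{n-2}(g\wedge S)$. For a $(0,4)$-tensor $H$ let $\mathcal{H}$ be the $(1,3)$-tensor with $g(\mathcal{H}(X,Y)Z,V)=H(X,Y,Z,V)$. For a symmetric $(0,2)$-tensor $E$ put $(X\wedge_E Y)Z=E(Y,Z)X-E(X,Z)Y$. For a $(0,k)$-tensor $T$: $(H\cdot T)(X_1,\dots,X_k,X,Y)=-\sum_{i=1}^k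 T(X_1,\dots,\mathcal{H}(X,Y)X_i,\dots,X_k)$ and $Q(E,T)(X_1,\dots,X_k;X,Y)=-\sum_{i=1}^k T(X_1,\dots,(X\wedge_E Y)X_i,\dots,X_k)$. Definitions. $M$ is: - Ricci simple (special quasi-Einstein) if $S=\beta\,\eta\otimes\eta$ for a scalar function $\beta$ and a 1-form $\eta$; - Ricci recurrent (resp. conformally recurrent, conharmonically recurrent) if there is a 1-form $A$ with $\nabla T=A\otimes T$ on $\{x: T_x\neq0\}$, where $T=S$ (resp. $T=C$, $T=K$); - generalized Ricci recurrent if there are 1-forms $A,B$ with $\nabla S=A\otimes S+B\otimes g$ on $\{x:S_x\neq0\}$; - weakly Ricci symmetric if there are 1-forms $A,B,D$ (the associated 1-forms) on $\{x:S_x\neq0\}$ such that there $(\nabla_XS)(X_1,X_2)=A(X)S(X_1,X_2)+B(X_1)S(X,X_2)+D(X_2)S(X_1,X)$; - conformally (resp. conharmonically) weakly symmetric if, with $H=C$ (resp. $H=K$), there are 1-forms $A,B,\overline B,D,\overline D$ (the associated 1-forms) on $\{x:H_x\ne0\}$ such that there $(\nabla_XH)(X_1,X_2,X_3,X_4)=A(X)H(X_1,X_2,X_3,X_4)+B(X_1)H(X,X_2,X_3,X_4)+\overline B(X_2)H(X_1,X,X_3,X_4)+D(X_3)H(X_1,X_2,X,X_4)+\overline D(X_4)H(X_1,X_2,X_3,X)$; - hyper-generalized recurrent if there are 1-forms $A,B$ with $\nabla R=A\otimes R+B\otimes(S\wedge g)$ on $\{x: R_x\neq0,\ (g\wedge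 S)_x\neq0\}$; - a manifold with Ricci generalized pseudosymmetric Weyl projective curvature tensor if $P\cdot P=L_2\,Q(S,P)$ on $\{x: Q(S,P)\neq0 \text{ at } x\}$ for a function $L_2$ on this set. The Ricci 1-forms are recurrent if there is a 1-form $A$ with $(\nabla_{X_1}S)(X_2,X)-(\nabla_{X_2}S)(X_1,X)=A(X_1)S(X_2,X)-A(X_2)S(X_1,X)$. For $H\in\{R,C,K\}$, the curvature 2-forms for $H$ are recurrent if there is a 1-form $A$ such that $(\nabla_{X_1}H)(X_2,X_3,X,Y)+(\nabla_{X_2}H)(X_3,X_1,X,Y)+(\nabla_{X_3}H)(X_1,X_2,X,Y)=A(X_1)H(X_2,X_3,X,Y)+A(X_2)H(X_3,X_1,X,Y)+A(X_3)H(X_1,X_2,X,Y)$.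
   Formalization: In (vii), for conharmonic weak symmetry, the 1-forms are shown pairwise different except for the pairs (B, B̄) and (D, D̄), which the antisymmetries of K force to be equal wherever K ≠ 0; M is taken non-empty. *)

(* Defs.v *)
From HB Require Import structures.
From mathcomp Require Import all_boot all_order all_algebra.
From mathcomp Require Import all_classical all_reals all_analysis.
From mathcomp Require Import ring.

Set Implicit Arguments.
Unset Strict Implicit.
Unset Printing Implicit Defensive.

Import Order.TTheory GRing.Theory Num.Theory.
Import numFieldNormedType.Exports.

Local Open Scope classical_set_scope.
Local Open Scope ring_scope.

(** * Tensor calculus on an open set of R^4 with its standard coordinates

    Points and tangent vectors are row vectors; the coordinates [x^1, ..., x^4]
    are [x 0 0], [x 0 1], [x 0 2], [x 0 3].  All fields are total functions on
    R^4, and only their values on the open set under consideration matter.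
    Covariant tensor fields are functions of vector fields, and tensor
    identities are required for all smooth vector fields. *)

Section Tensors.
Context {R : realType}.
Implicit Types (U M : set 'rV[R]_4) (x : 'rV[R]_4).

(** [C^n] on [U]: [f] is (Fréchet) differentiable on [U] and each of its
    directional derivatives is [C^(n-1)].  [U] is always open below. *)
Fixpoint Cn (n : nat) {V : normedModType R} U (f : 'rV[R]_4 -> V) : Prop :=
  match n with
  | 0 => forall x, U x -> {for x, continuous f}
  | n'.+1 => (forall x, U x -> differentiable f x) /\
             (forall v : 'rV[R]_4, Cn n' U (fun x => 'D_v f x))
  end.

Definition smooth {V : normedModType R} U (f : 'rV[R]_4 -> V) : Prop :=
  forall n, Cn n U f.

Definition scalar_field : Type := 'rV[R]_4 -> R.
Definition vector_field : Type := 'rV[R]_4 -> 'rV[R]_4.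

(** A 1-form is given by its row of components. *)
Definition one_form : Type := 'rV[R]_4 -> 'rV[R]_4.

Definition tensor2 : Type := vector_field -> vector_field -> scalar_field.
Definition tensor4 : Type :=
  vector_field -> vector_field -> vector_field -> vector_field -> scalar_field.
Definition tensor6 : Type :=
  vector_field -> vector_field -> vector_field -> vector_field ->
  vector_field -> vector_field -> scalar_field.

Implicit Types (X Y Z V : vector_field) (A B D : one_form).

Definition ev A X : scalar_field := fun x => \sum_(i < 4) A x 0 i * X x 0 i.

Definition frame (i : 'I_4) : vector_field := fun=> delta_mx 0 i.

Definition deriv_along X (f : scalar_field) : scalar_field :=
  fun x => 'D_(X x) f x.

Definition lie_bracket X Y : vector_field :=
  fun x => 'D_(X x) Y x - 'D_(Y x) X x.

(** ** Levi-Civita connection and curvature *)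

(** A metric is given by the matrix field of its components. *)
Definition metric_field : Type := 'rV[R]_4 -> 'M[R]_4.
Implicit Types g : metric_field.

Definition metric g : tensor2 :=
  fun X Y x => \sum_(i < 4) \sum_(j < 4) g x i j * X x 0 i * Y x 0 j.

Definition partial (i : 'I_4) (f : scalar_field) : scalar_field :=
  deriv_along (frame i) f.

(** [christoffel g k i j] is Γ^k_ij. *)
Definition christoffel g (k i j : 'I_4) : scalar_field := fun x =>
  2^-1 * \sum_(l < 4) invmx (g x) k l *
    (partial i (fun y => g y j l) x + partial j (fun y => g y i l) x
     - partial l (fun y => g y i j) x).

Definition nabla g X Y : vector_field := fun x =>
  'D_(X x) Y x +
  \row_(k < 4) \sum_(i < 4) \sum_(j < 4)
     christoffel g k i j x * X x 0 i * Y x 0 j.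

Definition curvature_op g X Y Z : vector_field := fun x =>
  nabla g X (nabla g Y Z) x - nabla g Y (nabla g X Z) x
  - nabla g (lie_bracket X Y) Z x.

Definition riemann g : tensor4 := fun X1 X2 X3 X4 =>
  metric g (curvature_op g X1 X2 X3) X4.

Definition ricci g : tensor2 := fun X2 X3 x =>
  \sum_(i < 4) \sum_(j < 4)
    invmx (g x) i j * riemann g (frame i) X2 X3 (frame j) x.

Definition scal g : scalar_field := fun x =>
  \sum_(i < 4) \sum_(j < 4) invmx (g x) i j * ricci g (frame i) (frame j) x.

(** ** Derived curvature tensors *)

Definition kulkarni_nomizu (J F : tensor2) : tensor4 := fun X1 X2 X3 X4 x =>
  J X1 X4 x * F X2 X3 x + J X2 X3 x * F X1 X4 x
  - J X1 X3 x * F X2 X4 x - J X2 X4 x * F X1 X3 x.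

Local Notation n := (4 : R).

Definition conformal g : tensor4 := fun X1 X2 X3 X4 x =>
  riemann g X1 X2 X3 X4 x
  - (n - 2)^-1 * kulkarni_nomizu (metric g) (ricci g) X1 X2 X3 X4 x
  + scal g x / (2 * (n - 1) * (n - 2))
    * kulkarni_nomizu (metric g) (metric g) X1 X2 X3 X4 x.

Definition projective g : tensor4 := fun X1 X2 X3 X4 x =>
  riemann g X1 X2 X3 X4 x
  - (n - 1)^-1 * (metric g X1 X4 x * ricci g X2 X3 x
                  - metric g X2 X4 x * ricci g X1 X3 x).

Definition concircular g : tensor4 := fun X1 X2 X3 X4 x =>
  riemann g X1 X2 X3 X4 x
  - scal g x / (2 * n * (n - 1))
    * kulkarni_nomizu (metric g) (metric g) X1 X2 X3 X4 x.

Definition conharmonic g : tensor4 := fun X1 X2 X3 X4 x =>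
  riemann g X1 X2 X3 X4 x
  - (n - 2)^-1 * kulkarni_nomizu (metric g) (ricci g) X1 X2 X3 X4 x.

(** ** Operations on tensors *)

(** The vector field [raise g H X Y Z] is the [W] with
    [g(W, V) = H(X, Y, Z, V)]: its components are [H(X, Y, Z, e_i) g^(ij)]. *)
Definition raise g (H : tensor4) X Y Z : vector_field := fun x =>
  (\row_(i < 4) H X Y Z (frame i) x) *m invmx (g x).

Definition act2 g (H : tensor4) (T : tensor2) : tensor4 := fun X1 X2 X Y x =>
  - (T (raise g H X Y X1) X2 x + T X1 (raise g H X Y X2) x).

Definition act4 g (H T : tensor4) : tensor6 := fun X1 X2 X3 X4 X Y x =>
  - (T (raise g H X Y X1) X2 X3 X4 x + T X1 (raise g H X Y X2) X3 X4 x
     + T X1 X2 (raise g H X Y X3) X4 x + T X1 X2 X3 (raise g H X Y X4) x).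

Definition wedge_op (E : tensor2) X Y Z : vector_field := fun x =>
  E Y Z x *: X x - E X Z x *: Y x.

Definition tachibana (E : tensor2) (T : tensor4) : tensor6 :=
  fun X1 X2 X3 X4 X Y x =>
  - (T (wedge_op E X Y X1) X2 X3 X4 x + T X1 (wedge_op E X Y X2) X3 X4 x
     + T X1 X2 (wedge_op E X Y X3) X4 x + T X1 X2 X3 (wedge_op E X Y X4) x).

(** [cov2 g T X] and [cov4 g T X] are the covariant derivative of [T]
    along [X]. *)
Definition cov2 g (T : tensor2) X : tensor2 := fun X1 X2 x =>
  deriv_along X (T X1 X2) x - T (nabla g X X1) X2 x - T X1 (nabla g X X2) x.

Definition cov4 g (T : tensor4) X : tensor4 := fun X1 X2 X3 X4 x =>
  deriv_along X (T X1 X2 X3 X4) x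
  - T (nabla g X X1) X2 X3 X4 x - T X1 (nabla g X X2) X3 X4 x
  - T X1 X2 (nabla g X X3) X4 x - T X1 X2 X3 (nabla g X X4) x.

(** ** Points of [M] where a tensor does not vanish *)

Definition nonzero2 M (T : tensor2) : set 'rV[R]_4 := [set x | M x /\
  exists X1 X2, [/\ smooth M X1, smooth M X2 & T X1 X2 x != 0]].

Definition nonzero4 M (T : tensor4) : set 'rV[R]_4 := [set x | M x /\
  exists X1 X2 X3 X4,
    [/\ smooth M X1, smooth M X2, smooth M X3, smooth M X4
      & T X1 X2 X3 X4 x != 0]].

Definition nonzero6 M (T : tensor6) : set 'rV[R]_4 := [set x | M x /\
  exists X1 X2 X3 X4 X5 X6,
    [/\ smooth M X1, smooth M X2, smooth M X3 & smooth M X4] /\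
    [/\ smooth M X5, smooth M X6 & T X1 X2 X3 X4 X5 X6 x != 0]].

(** ** Identities over [U], for vector fields on [M] *)

Definition eq2 M U (T T' : tensor2) : Prop := forall X1 X2,
  smooth M X1 -> smooth M X2 -> forall x, U x -> T X1 X2 x = T' X1 X2 x.

Definition eq4 M U (T T' : tensor4) : Prop := forall X1 X2 X3 X4,
  smooth M X1 -> smooth M X2 -> smooth M X3 -> smooth M X4 ->
  forall x, U x -> T X1 X2 X3 X4 x = T' X1 X2 X3 X4 x.

Definition eq6 M U (T T' : tensor6) : Prop := forall X1 X2 X3 X4 X5 X6,
  smooth M X1 -> smooth M X2 -> smooth M X3 -> smooth M X4 ->
  smooth M X5 -> smooth M X6 ->
  forall x, U x -> T X1 X2 X3 X4 X5 X6 x = T' X1 X2 X3 X4 X5 X6 x.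

(** Two 1-forms on [U] are different if they differ at some point of [U]. *)
Definition form_neq U A B : Prop := exists2 x, U x & A x != B x.

(** ** Geometric structures *)

Definition ricci_simple M g : Prop :=
  exists (beta : scalar_field) (eta : one_form),
    [/\ smooth M (beta : _ -> R^o), smooth M eta
      & eq2 M M (ricci g) (fun X1 X2 x => beta x * (ev eta X1 x * ev eta X2 x))].

Definition constant_scalar_curvature M g : Prop :=
  exists c : R, forall x, M x -> scal g x = c.

Definition recurrent2 M g (T : tensor2) : Prop :=
  let U := nonzero2 M T in
  exists A, smooth U A /\ forall X, smooth M X ->
    eq2 M U (cov2 g T X) (fun X1 X2 x => ev A X x * T X1 X2 x).

Definition recurrent4 M g (T : tensor4) : Prop :=
  let U := nonzero4 M T in
  exists A, smooth U A /\ forall X, smooth M X ->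
    eq4 M U (cov4 g T X) (fun X1 X2 X3 X4 x => ev A X x * T X1 X2 X3 X4 x).

Definition ricci_recurrent M g : Prop := recurrent2 M g (ricci g).
Definition conformally_recurrent M g : Prop := recurrent4 M g (conformal g).
Definition conharmonically_recurrent M g : Prop :=
  recurrent4 M g (conharmonic g).

Definition generalized_ricci_recurrent M g : Prop :=
  let S := ricci g in
  let U := nonzero2 M S in
  exists A B, [/\ smooth U A, smooth U B & forall X, smooth M X ->
    eq2 M U (cov2 g S X)
      (fun X1 X2 x => ev A X x * S X1 X2 x + ev B X x * metric g X1 X2 x)].

Definition weakly_ricci_symmetric_with M g A B D : Prop :=
  let S := ricci g in
  let U := nonzero2 M S in
  [/\ smooth U A, smooth U B, smooth U D & forall X, smooth M X ->
    eq2 M U (cov2 g S X)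
      (fun X1 X2 x => ev A X x * S X1 X2 x + ev B X1 x * S X X2 x
                      + ev D X2 x * S X1 X x)].

Definition weakly_ricci_symmetric M g : Prop :=
  exists A B D, weakly_ricci_symmetric_with M g A B D.

(** If [H] is antisymmetric in its first two and in its last two arguments,
    then [B = B'] and [D = D'] where [H] does not vanish: adding
    the identity to the one with [X1], [X2] exchanged and taking [X1 = X2 = u]
    gives [(B - B')(u) H(X, u, X3, X4) = 0] for all [u]. *)
Definition weakly_symmetric_with M g (H : tensor4) A B B' D D' : Prop :=
  let U := nonzero4 M H in
  [/\ smooth U A, smooth U B, smooth U B', smooth U D
    & smooth U D' /\ forall X, smooth M X ->
    eq4 M U (cov4 g H X)
      (fun X1 X2 X3 X4 x =>
         ev A X x * H X1 X2 X3 X4 x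
         + ev B X1 x * H X X2 X3 X4 x + ev B' X2 x * H X1 X X3 X4 x
         + ev D X3 x * H X1 X2 X X4 x + ev D' X4 x * H X1 X2 X3 X x)].

Definition weakly_symmetric M g (H : tensor4) : Prop :=
  exists A B B' D D', weakly_symmetric_with M g H A B B' D D'.

Definition conformally_weakly_symmetric M g : Prop :=
  weakly_symmetric M g (conformal g).
Definition conharmonically_weakly_symmetric M g : Prop :=
  weakly_symmetric M g (conharmonic g).

Definition hyper_generalized_recurrent M g : Prop :=
  let S := ricci g in
  let U := nonzero4 M (riemann g)
           `&` nonzero4 M (kulkarni_nomizu (metric g) S) in
  exists A B, [/\ smooth U A, smooth U B & forall X, smooth M X ->
    eq4 M U (cov4 g (riemann g) X)
      (fun X1 X2 X3 X4 x =>
         ev A X x * riemann g X1 X2 X3 X4 x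
         + ev B X x * kulkarni_nomizu S (metric g) X1 X2 X3 X4 x)].

Definition ricci_generalized_pseudosymmetric_projective M g : Prop :=
  let Q := tachibana (ricci g) (projective g) in
  let U := nonzero6 M Q in
  exists L2 : scalar_field, smooth U (L2 : _ -> R^o) /\
    eq6 M U (act4 g (projective g) (projective g))
      (fun X1 X2 X3 X4 X Y x => L2 x * Q X1 X2 X3 X4 X Y x).

Definition recurrent_ricci_one_forms M g : Prop :=
  let S := ricci g in
  exists A, smooth M A /\
    forall X1 X2 X, smooth M X1 -> smooth M X2 -> smooth M X ->
    forall x, M x ->
      cov2 g S X1 X2 X x - cov2 g S X2 X1 X x
      = ev A X1 x * S X2 X x - ev A X2 x * S X1 X x.

Definition recurrent_curvature_two_forms M g (H : tensor4) : Prop :=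
  exists A, smooth M A /\
    forall X1 X2 X3 X Y, smooth M X1 -> smooth M X2 -> smooth M X3 ->
      smooth M X -> smooth M Y ->
    forall x, M x ->
      cov4 g H X1 X2 X3 X Y x + cov4 g H X2 X3 X1 X Y x
        + cov4 g H X3 X1 X2 X Y x
      = ev A X1 x * H X2 X3 X Y x + ev A X2 x * H X3 X1 X Y x
        + ev A X3 x * H X1 X2 X Y x.

Definition semisymmetric2 M g (T : tensor2) : Prop :=
  eq4 M M (act2 g (riemann g) T) (fun _ _ _ _ _ => 0).

Definition semisymmetric4 M g (T : tensor4) : Prop :=
  eq6 M M (act4 g (riemann g) T) (fun _ _ _ _ _ _ _ => 0).

(** ** The metric *)

(** [e^(x^1 + x^3) (dx^1)^2 + 2 dx^1 dx^2 + (dx^3)^2 + e^(x^1) (dx^4)^2]. *)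
Definition the_metric : metric_field := fun x =>
  expR (x 0 0 + x 0 2) *: delta_mx 0 0
  + (delta_mx 0 1 + delta_mx 1 0)
  + delta_mx 2 2
  + expR (x 0 0) *: delta_mx 3 3.

(** ** [nabla g] is torsion-free and compatible with [g], and
    [the_metric] is the intended quadratic form *)

Section LeviCivita.
Context (g : metric_field).

Lemma christoffelC k i j x : (forall y, (g y)^T = g y) ->
  christoffel g k i j x = christoffel g k j i x.
Proof.
move=> gT; rewrite /christoffel; congr (_ * _); apply: eq_bigr => l _.
congr (_ * _); rewrite [X in X - _]addrC; congr (_ - partial l _ x).
by apply/funext => y; rewrite -[in LHS]gT mxE.
Qed.

Lemma nabla_torsion_free X Y x : (forall y, (g y)^T = g y) ->
  nabla g X Y x - nabla g Y X x = lie_bracket X Y x.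
Proof.
move=> gT; rewrite /nabla /lie_bracket.
rewrite [X in _ + X - _](_ : _ = \row_(k < 4) \sum_(i < 4) \sum_(j < 4)
     christoffel g k i j x * Y x 0 i * X x 0 j); first by rewrite opprD addrACA subrr addr0.
apply/rowP => k; rewrite !mxE exchange_big; apply: eq_bigr => i _ /=.
by apply: eq_bigr => j _; rewrite christoffelC// mulrAC.
Qed.

Lemma christoffel_lower m i j x : (forall y, (g y)^T = g y) ->
  g x \in unitmx ->
  \sum_(k < 4) g x k j * christoffel g k m i x =
  2^-1 * (partial m (fun y => g y i j) x + partial i (fun y => g y m j) x
     - partial j (fun y => g y m i) x).
Proof.
move=> gT gU; rewrite /christoffel.
pose L (l : 'I_4) := partial m (fun y => g y i l) x + partial i (fun y => g y m l) x
     - partial l (fun y => g y m i) x.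
transitivity (2^-1 * \sum_l (\sum_k g x j k * invmx (g x) k l) * L l).
  have gs k : g x k j = g x j k by rewrite -[in LHS](gT x) mxE.
  rewrite [RHS]mulr_sumr.
  under [RHS]eq_bigr do rewrite mulr_suml mulr_sumr.
  rewrite exchange_big; apply: eq_bigr => k _ /=.
  rewrite !mulr_sumr; apply: eq_bigr => l _.
  by rewrite gs /L; ring.
congr (_ * _); rewrite (bigD1 j)//= [X in _ + X]big1 ?addr0.
  have := congr1 (fun M : 'M[R]_4 => M j j) (mulmxV gU); rewrite !mxE eqxx => ->.
  by rewrite mul1r.
move=> l lj; have := congr1 (fun M : 'M[R]_4 => M j l) (mulmxV gU).
by rewrite !mxE eq_sym (negPf lj) => ->; rewrite mul0r.
Qed.

Lemma nabla_metric X Y Z x : (forall y, (g y)^T = g y) ->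
  g x \in unitmx ->
  (forall i j, differentiable (fun y => g y i j : R^o) x) ->
  differentiable Y x -> differentiable Z x ->
  deriv_along X (metric g Y Z) x =
  metric g (nabla g X Y) Z x + metric g Y (nabla g X Z) x.
Proof.
move=> gT gU dg dY dZ.
have dYi i : derivable (fun y => Y y 0 i) x (X x).
  by apply: (derivable_mxP Y x (X x)).1; exact: diff_derivable.
have dZi i : derivable (fun y => Z y 0 i) x (X x).
  by apply: (derivable_mxP Z x (X x)).1; exact: diff_derivable.
have DY i : ('D_(X x) Y x) 0 i = 'D_(X x) (fun y => Y y 0 i) x.
  by rewrite derive_mx ?mxE//; exact: diff_derivable.
have DZ i : ('D_(X x) Z x) 0 i = 'D_(X x) (fun y => Z y 0 i) x.
  by rewrite derive_mx ?mxE//; exact: diff_derivable.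
have Dg i j : 'D_(X x) (fun y => g y i j) x =
    \sum_m X x 0 m * partial m (fun y => g y i j) x.
  rewrite deriveE//.
  rewrite [in LHS](row_sum_delta (X x)) linear_sum; apply: eq_bigr => m _.
  by rewrite linearZ /= /partial /deriv_along deriveE.
have -> : deriv_along X (metric g Y Z) x = \sum_i \sum_j
   ('D_(X x) (fun y => g y i j) x * Y x 0 i * Z x 0 j
    + (g x i j * ('D_(X x) Y x) 0 i * Z x 0 j + g x i j * Y x 0 i * ('D_(X x) Z x) 0 j)).
  rewrite /deriv_along.
  have -> : metric g Y Z = \sum_(i < 4) \sum_(j < 4)
     ((fun y => g y i j) * (fun y => Y y 0 i) * (fun y => Z y 0 j)).
    by apply/funext => y; rewrite /metric fct_sumE; apply: eq_bigr => i _; rewrite fct_sumE.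
  have dgi i j : derivable (fun y => g y i j) x (X x) by exact: diff_derivable.
  rewrite derive_sum; last first.
    by move=> i; apply: derivable_sum => j; do 2!apply: derivableM => //.
  apply: eq_bigr => i _; rewrite derive_sum; last first.
    by move=> j; do 2!apply: derivableM => //.
  apply: eq_bigr => j _; rewrite deriveM//; last exact: derivableM.
  rewrite deriveM// DY DZ /GRing.scale/=; rewrite !fctE; ring.
have -> : metric g (nabla g X Y) Z x + metric g Y (nabla g X Z) x =
  \sum_i \sum_j
    ((g x i j * (\sum_m \sum_k christoffel g i m k x * X x 0 m * Y x 0 k) * Z x 0 j
      + g x i j * Y x 0 i * (\sum_m \sum_k christoffel g j m k x * X x 0 m * Z x 0 k)) +
     (g x i j * ('D_(X x) Y x) 0 i * Z x 0 j + g x i j * Y x 0 i * ('D_(X x) Z x) 0 j)).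
  rewrite /metric -big_split; apply: eq_bigr => i _ /=.
  rewrite -big_split; apply: eq_bigr => j _ /=.
  by rewrite /nabla !mxE; ring.
under [LHS]eq_bigr do rewrite big_split /=.
under [RHS]eq_bigr do rewrite big_split /=.
rewrite !big_split /=; congr (_ + _).
under [RHS]eq_bigr do rewrite big_split /=.
rewrite big_split /=.
have -> : \sum_i \sum_j g x i j * (\sum_m \sum_k christoffel g i m k x * X x 0 m * Y x 0 k) * Z x 0 j
   = \sum_i \sum_j \sum_m (\sum_k g x k j * christoffel g k m i x) * (X x 0 m * Y x 0 i * Z x 0 j).
  rewrite exchange_big [RHS]exchange_big; apply: eq_bigr => j _ /=.
  under [LHS]eq_bigr do rewrite mulr_sumr mulr_suml.
  rewrite exchange_big [RHS]exchange_big; apply: eq_bigr => m _ /=.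
  under [LHS]eq_bigr do rewrite mulr_sumr mulr_suml.
  rewrite exchange_big; apply: eq_bigr => k _ /=.
  by rewrite mulr_suml; apply: eq_bigr => i _; ring.
have -> : \sum_i \sum_j g x i j * Y x 0 i * (\sum_m \sum_k christoffel g j m k x * X x 0 m * Z x 0 k)
   = \sum_i \sum_j \sum_m (\sum_k g x k i * christoffel g k m j x) * (X x 0 m * Y x 0 i * Z x 0 j).
  apply: eq_bigr => i _ /=.
  under [LHS]eq_bigr do rewrite mulr_sumr.
  rewrite exchange_big [RHS]exchange_big; apply: eq_bigr => m _ /=.
  under [LHS]eq_bigr do rewrite mulr_sumr.
  rewrite exchange_big; apply: eq_bigr => k _ /=.
  rewrite mulr_suml; apply: eq_bigr => j _.
  by rewrite -[in LHS](gT x) mxE; ring.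
rewrite -big_split; apply: eq_bigr => i _ /=.
rewrite -big_split; apply: eq_bigr => j _ /=.
rewrite -big_split Dg !mulr_suml; apply: eq_bigr => m _ /=.
rewrite !christoffel_lower//.
have -> : partial m (fun y => g y j i) x = partial m (fun y => g y i j) x.
  by congr (partial m _ x); apply/funext => y; rewrite -[in LHS]gT mxE.
by field.
Qed.

End LeviCivita.

Lemma the_metric_sym (x : 'rV[R]_4) : (the_metric x)^T = the_metric x.
Proof.
by rewrite /the_metric !linearD /= !linearZ /= !trmx_delta (addrC (delta_mx 1 0)).
Qed.

Lemma the_metricE (X Y : 'rV[R]_4 -> 'rV[R]_4) x :
  metric the_metric X Y x =
  expR (x 0 0 + x 0 2) * X x 0 0 * Y x 0 0
  + (X x 0 0 * Y x 0 1 + X x 0 1 * Y x 0 0)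
  + X x 0 2 * Y x 0 2 + expR (x 0 0) * X x 0 3 * Y x 0 3.
Proof.
rewrite /metric !big_ord_recl !big_ord0 /the_metric !mxE /=.
have -> : lift ord0 ord0 = 1 :> 'I_4 by apply/val_inj.
have -> : lift ord0 (lift ord0 ord0) = 2 :> 'I_4 by apply/val_inj.
have -> : lift ord0 (lift ord0 (lift ord0 ord0)) = 3 :> 'I_4 by apply/val_inj.
have -> : ord0 = 0 :> 'I_4 by [].
rewrite ?mulr0n ?mulr1n. ring.
Qed.

End Tensors.

(* Main.v *)
Require Import Defs.
From HB Require Import structures.
From mathcomp Require Import all_boot all_order all_algebra.
From mathcomp Require Import all_classical all_reals all_analysis.
From mathcomp Require Import ring lra.

Set Implicit Arguments.
Unset Strict Implicit.
Unset Printing Implicit Defensive.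

Import Order.TTheory GRing.Theory Num.Theory.
Import numFieldNormedType.Exports.
Local Open Scope classical_set_scope.
Local Open Scope ring_scope.

(** Write [F = e^(x^1 + x^3)], [h = e^(x^1)] and [k = dx^1]; the coordinate [x^(i+1)] is the
    entry of index [i] of a row.

    The metric is of pp-wave type: [k] is null and parallel, and the curvature is built
    from the two 2-forms [k ∧ dx^3] and [k ∧ dx^4] alone, namely
    [R = F/2 (k ∧ dx^3)^2 + 1/4 h (k ∧ dx^4)^2] (lemma [riemannE]).  Tracing gives
    [S = - (2F + 1)/4 k ⊗ k] ([ricciE]); as [k] is null the scalar curvature vanishes, so that
    [W = R] and [C = K], and removing the trace from [R] leaves
    [K = (2F - 1)/8 ((k ∧ dx^3)^2 - h (k ∧ dx^4)^2)] ([conharmonicE]).  The coefficient is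
    nonzero because [F > 1] where [x^1] and [x^3] are positive.

    Covariant derivatives are immediate from this normal form.  The 2-form [k ∧ dx^3] is
    parallel, and [∇(k ∧ dx^4) = - 1/2 k ⊗ (k ∧ dx^4)] is exactly compensated by
    [dh = h k]; hence a tensor [p (k ∧ dx^3)^2 + q h (k ∧ dx^4)^2] is differentiated by
    differentiating [p] and [q] ([cov4_wave]).  Since [dF = F (dx^1 + dx^3)], the tensors [S] and
    [K], each a function of [F] times a parallel tensor, are recurrent with a 1-form
    proportional to [dx^1 + dx^3], and [∇R] is a combination of [R] and [S ∧ g] by solving a
    linear system for two coefficients.  For [R] the cyclic sum is the second Bianchi
    identity.

    Weak symmetry, and the freedom in its 1-forms, comes from the identities
    [k(X1) S(X, X2) = k(X) S(X1, X2)] and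
    [k(X1) K(X, X2, ., .) + k(X2) K(X1, X, ., .) = k(X) K(X1, X2, ., .)]: any multiple of [k]
    can be moved from the first associated 1-form to the others.

    For semisymmetry, [R(X, Y)] is skew for [g], takes values in the kernel of [k], and kills
    both 2-forms when it acts as a derivation ([minor_curvature_op]), so it kills every tensor
    made of [g], [S] and these 2-forms.  Raising the last index of the projective tensor
    gives [R(X, Y) - 1/3 X ∧_S Y] ([raise_projective]); therefore
    [P·P = R·P - 1/3 Q(S, P) = - 1/3 Q(S, P)].

    The definition of the curvature operator differentiates [Z] twice, and the second
    derivatives of [Z] cancel only by the symmetry of second derivatives of smooth functions,
    which is proved first ([derive_comm]). *)

(** * Closure properties of smooth functions *)

Section Smooth.
Context {R : realType}.
Implicit Types (U : set 'rV[R]_4) (x u v : 'rV[R]_4) (n : nat).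

(** Differentiability depends on the germ only: the remainder estimate for [f] is one for [g]. *)
Lemma near_eq_differentiable (V W : normedModType R) (f g : V -> W) (x : V) :
  (\near x, f x = g x) -> differentiable f x -> differentiable g x.
Proof.
move=> fg /diff_locallyP[dc df].
have dg : g \o shift x = cst (g x) + 'd f x +o_ 0 id.
  apply/eqaddoP => e e0; move/eqaddoP : df => /(_ e e0).
  have fgs : \forall h \near (0 : V), f (h + x) = g (h + x).
    by move: fg; rewrite (near_shift 0 x) subr0.
  by apply: filterS2 fgs => h /= fgh; rewrite !fctE /= fgh (nbhs_singleton fg).
by apply/diff_locallyP; rewrite (diff_unique dc dg).
Qed.

Section Closure.
Context {V : normedModType R}.
Implicit Types f g : 'rV[R]_4 -> V.

Lemma eq_near_open U f g x : open U -> (forall y, U y -> f y = g y) -> U x ->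
  \near x, f x = g x.
Proof.
move=> oU fg Ux; apply: filterS (open_nbhs_nbhs (conj oU Ux)) => y; exact: fg.
Qed.

Lemma Cn_sub n U U' f : U' `<=` U -> Cn n U f -> Cn n U' f.
Proof.
move=> sU; elim: n f => [|n IH] f /=; first by move=> cf x /sU; exact: cf.
by case=> df Df; split=> [x /sU|v]; [exact: df|exact: IH].
Qed.

(** Curvature fields agree with explicit smooth expressions on an open set only; this carries
    smoothness over to them. *)
Lemma Cn_eq n U f g : open U -> (forall y, U y -> f y = g y) ->
  Cn n U f -> Cn n U g.
Proof.
move=> oU; elim: n f g => [|n IH] f g fg /=.
  move=> cf x Ux; have fgx := eq_near_open oU fg Ux.
  rewrite /prop_for /continuous_at -fg//; apply: cvg_trans (cf _ Ux); exact: near_eq_cvg fgx.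
case=> df Df; split=> [x Ux|v].
  exact: near_eq_differentiable (eq_near_open oU fg Ux) (df _ Ux).
by apply: IH (Df v) => x Ux; apply: near_eq_derive (eq_near_open oU fg Ux).
Qed.

Lemma CnW n U f : Cn n.+1 U f -> Cn n U f.
Proof.
elim: n f => [|n IH] f /=.
  by case=> df _ x Ux; apply: differentiable_continuous; exact: df.
by case=> df Df; split=> // v; apply: IH; exact: Df.
Qed.

Lemma Cn_cst n U (a : V) : Cn n U (cst a).
Proof.
elim: n a => [|n IH] a /=; first by move=> x _; exact: cst_continuous.
split=> [x _|v]; first exact: differentiable_cst.
have -> : (fun x => 'D_v (cst a) x) = cst 0 by apply/funext => x; rewrite derive_cst.
exact: IH.
Qed.

Lemma Cn_add n U f g : open U -> Cn n U f -> Cn n U g ->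
  Cn n U (fun x => f x + g x).
Proof.
move=> oU; elim: n f g => [|n IH] f g /=.
  by move=> cf cg x Ux; apply: continuousD; [exact: cf|exact: cg].
case=> df Df [dg Dg]; split=> [x Ux|v].
  by apply: differentiableD; [exact: df|exact: dg].
apply: Cn_eq oU _ (IH _ _ (Df v) (Dg v)) => x Ux.
by rewrite -deriveD//; apply: diff_derivable; [exact: df|exact: dg].
Qed.

Lemma Cn_scale n U (k : 'rV[R]_4 -> R) (a : V) : open U -> Cn n U k ->
  Cn n U (fun x => k x *: a).
Proof.
move=> oU; elim: n k => [|n IH] k /=.
  by move=> ck x Ux; apply: continuousZr_tmp; exact: ck.
case=> dk Dk; split=> [x Ux|v].
  by apply: differentiableZl; exact: dk.
apply: Cn_eq oU _ (IH _ (Dk v)) => x Ux.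
have dkx := dk x Ux.
by rewrite !deriveE//; [rewrite diffZl|exact: differentiableZl].
Qed.

End Closure.

Section Scalar.
Implicit Types f g : 'rV[R]_4 -> R.

Lemma Cn_mul n U f g : open U -> Cn n U f -> Cn n U g ->
  Cn n U (fun x => f x * g x).
Proof.
move=> oU; elim: n f g => [|n IH] f g Hf Hg.
  by move=> x Ux; apply: continuousM; [exact: Hf|exact: Hg].
have [df Df] := Hf; have [dg Dg] := Hg.
split=> [x Ux|v]; first by apply: differentiableM; [exact: df|exact: dg].
apply: (Cn_eq (f := fun x => f x * 'D_v g x + g x * 'D_v f x)) => //.
  move=> x Ux; rewrite [RHS](@deriveM _ _ f g)//; apply: diff_derivable; [exact: df|exact: dg].
have Hf' := CnW Hf; have Hg' := CnW Hg.
apply: Cn_add => //; [exact: IH Hf' (Dg v)|exact: IH Hg' (Df v)].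
Qed.

Lemma Cn_opp n U f : open U -> Cn n U f -> Cn n U (fun x => - f x).
Proof.
move=> oU Hf; have := Cn_mul oU (@Cn_cst _ n U (-1 : R)) Hf.
by apply: Cn_eq => // y _; rewrite mulN1r.
Qed.

Lemma Cn_inv n U f : open U -> (forall x, U x -> f x != 0) -> Cn n U f ->
  Cn n U (fun x => (f x)^-1).
Proof.
move=> oU f0; elim: n => [|n IH] Hf.
  by move=> x Ux; apply: continuousV; [exact: f0|exact: Hf].
have [df Df] := Hf; have Hi := IH (CnW Hf).
split=> [x Ux|v]; first by apply: differentiableV; [exact: df|exact: f0].
apply: (Cn_eq (f := fun x => - ((f x)^-1 * (f x)^-1 * 'D_v f x))) => //.
  move=> x Ux; rewrite deriveV ?f0//; last by apply: diff_derivable; exact: df.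
  by rewrite /GRing.scale /= -exprVn expr2 mulNr.
apply: (@Cn_opp n U (fun x => (f x)^-1 * (f x)^-1 * 'D_v f x)) => //.
exact: Cn_mul oU (Cn_mul oU Hi Hi) (Df v).
Qed.

Lemma derive_expR_comp f x v : differentiable f x ->
  'D_v (fun y => expR (f y)) x = expR (f x) * 'D_v f x /\
  differentiable (fun y => expR (f y)) x.
Proof.
move=> df.
have de : differentiable (expR : R -> R) (f x).
  by apply/derivable1_diffP; exact: derivable_expR.
have dc : differentiable (expR \o f) x by exact: differentiable_comp.
split=> //; rewrite deriveE// (diff_comp df de) /= deriveE//.
by rewrite (deriv1E (@derivable_expR R (f x))) derive1E derive_val [RHS]mulrC.
Qed.

Lemma Cn_coord n U (X : 'rV[R]_4 -> 'rV[R]_4) i : open U -> Cn n U X ->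
  Cn n U (fun x => X x 0 i).
Proof.
move=> oU; elim: n X => [|n IH] X HX.
  by move=> x Ux;
    exact: (@continuous_comp _ _ _ X (fun y : 'rV[R]_4 => y 0 i) x (HX x Ux)
      (@coord_continuous _ _ _ 0 i _)).
have [dX DX] := HX; split=> [x Ux|v].
  exact: (differentiable_comp (dX x Ux) (differentiable_coord _ 0 i)).
apply: Cn_eq oU _ (IH _ (DX v)) => x Ux.
by rewrite derive_mx ?mxE//; apply: diff_derivable; exact: dX.
Qed.

Lemma Cn_vector n U (X : 'rV[R]_4 -> 'rV[R]_4) : open U ->
  (forall i, Cn n U (fun x => X x 0 i)) -> Cn n U X.
Proof.
move=> oU HX.
have HXi i : Cn n U (fun x => X x 0 i *: (delta_mx 0 i : 'rV[R]_4)).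
  exact: Cn_scale.
apply: (Cn_eq (f := fun x => X x 0 0 *: delta_mx 0 0 + X x 0 1 *: delta_mx 0 1
   + X x 0 2 *: delta_mx 0 2 + X x 0 3 *: delta_mx 0 3)) => //; last first.
  do 3 (apply: Cn_add => //).
move=> x _; rewrite [RHS]row_sum_delta.
rewrite !big_ord_recr big_ord0 /= add0r.
by do 3?congr (_ + _); congr (X x 0 _ *: delta_mx 0 _); apply/val_inj.
Qed.

Lemma Cn_expR n U f : open U -> Cn n U f -> Cn n U (fun x => expR (f x)).
Proof.
move=> oU; elim: n => [|n IH] Hf.
  by move=> x Ux; apply: (continuous_comp (Hf x Ux)); exact: continuous_expR.
have [df Df] := Hf; split=> [x Ux|v].
  by have [] := derive_expR_comp 0 (df x Ux).
apply: (Cn_eq (f := fun x => expR (f x) * 'D_v f x)) => //.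
  by move=> x Ux; have [->] := derive_expR_comp v (df x Ux).
exact: Cn_mul oU (IH (CnW Hf)) (Df v).
Qed.

Lemma Cn_coordinate n U i : Cn n U (fun x : 'rV[R]_4 => x 0 i).
Proof.
have D v : (fun x : 'rV[R]_4 => 'D_v (fun y : 'rV[R]_4 => y 0 i) x) = cst (v 0 i).
  apply/funext => x.
  have := derive_mx (@derivable_id _ _ x v) => /(congr1 (fun A : 'rV[R]_4 => A 0 i)).
  by rewrite derive_id mxE => <-.
case: n => [|n]; first by move=> x _; exact: coord_continuous.
split=> [x _|v]; first exact: differentiable_coord.
by rewrite D; exact: Cn_cst.
Qed.

(** * Symmetry of second derivatives *)

Lemma is_derive_line f x v s : differentiable f (x + s *: v) ->
  is_derive s 1 (fun t => f (x + t *: v)) ('D_v f (x + s *: v)).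
Proof.
move=> df.
have dl : is_diff s (fun t : R => x + t *: v) (0 + *:%R ^~ v).
  exact: (is_diffD (is_diff_cst x s) (is_diff_scalel s v)).
have dfl := is_diff_comp dl (differentiableP df).
apply: DeriveDef; first by apply: diff_derivable; apply: ex_diff.
rewrite deriveE; last exact: ex_diff.
by rewrite [in LHS](@diff_val _ _ _ _ _ _ _ dfl) /= add0r scale1r deriveE.
Qed.

(** The mean value theorem along [u], for the increment of [f] in direction [v], and then
    along [v], for ['D_u f]. *)
Lemma second_difference U f u v x (t : R) : Cn 2 U f -> 0 < t ->
  (forall a b : R, a \in `[0, t] -> b \in `[0, t] -> U (x + a *: u + b *: v)) ->
  exists a b : R, [/\ a \in `[0, t], b \in `[0, t] &
    f (x + t *: u + t *: v) - f (x + t *: u) - (f (x + t *: v) - f x) =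
    'D_v (fun y => 'D_u f y) (x + a *: u + b *: v) * t * t].
Proof.
move=> [df Df] t0 tU.
have t_in : t \in `[0, t] by rewrite in_itv /= lexx ltW.
have z_in : 0 \in `[0, t] by rewrite in_itv /= lexx ltW.
have t0' : (0 : R) <= t by exact: ltW.
pose k (s : R) : R := f (x + t *: v + s *: u) - f (x + s *: u).
pose k' (s : R) : R := 'D_u f (x + t *: v + s *: u) - 'D_u f (x + s *: u).
have dk (s : R) : s \in `[0, t] -> is_derive s 1 k (k' s).
  move=> s_in; apply: is_deriveB; apply: is_derive_line; apply: df.
    by rewrite addrAC; exact: tU.
  by have := tU _ _ s_in z_in; rewrite scale0r addr0.
have ko (s : R) : s \in `]0, t[ -> is_derive s 1 k (k' s).
  by move=> s_in; apply: dk; exact: subset_itv_oo_cc s_in.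
have kc : {within `[0, t], continuous k}.
  by apply: derivable_within_continuous => s /dk /@ex_derive.
have [a a_in] := MVT_segment t0' ko kc.
rewrite subr0 => ka.
pose l (s : R) : R := 'D_u f (x + a *: u + s *: v).
pose l' (s : R) : R := 'D_v (fun y => 'D_u f y) (x + a *: u + s *: v).
have dl (s : R) : s \in `[0, t] -> is_derive s 1 l (l' s).
  by move=> s_in; apply: is_derive_line; apply: (Df u).1; exact: tU.
have lo (s : R) : s \in `]0, t[ -> is_derive s 1 l (l' s).
  by move=> s_in; apply: dl; exact: subset_itv_oo_cc s_in.
have lc : {within `[0, t], continuous l}.
  by apply: derivable_within_continuous => s /dl /@ex_derive.
have [b b_in] := MVT_segment t0' lo lc.
rewrite subr0 => lb.
exists a, b; split => //; rewrite -lb /l scale0r addr0.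
by rewrite [x + a *: u + _]addrAC -ka /k scale0r !addr0 [x + t *: u + _]addrAC.
Qed.

(** The second difference is symmetric in [u] and [v], so both mixed derivatives take a
    common value (at different points) in every small parallelogram at [x]; continuity
    brings the points to [x]. *)
Lemma derive_comm U f u v x : open U -> Cn 2 U f -> U x ->
  'D_v (fun y => 'D_u f y) x = 'D_u (fun y => 'D_v f y) x.
Proof.
move=> oU Cf Ux.
apply/eqP; rewrite -subr_eq0 -normr_le0; apply/ler_addgt0Pl => e e0; rewrite addr0.
have c1 : {for x, continuous ('D_v (fun y => 'D_u f y))} by apply: (Cf.2 u).2.
have c2 : {for x, continuous ('D_u (fun y => 'D_v f y))} by apply: (Cf.2 v).2.
have e20 : 0 < e / 2 by rewrite divr_gt0.
have := open_nbhs_nbhs (conj oU Ux).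
move/cvgrPdist_le : c1 => /(_ _ e20); move/cvgrPdist_le : c2 => /(_ _ e20).
move=> n1 n2 n3.
have [d /= d0 dB] := (nbhs_ballP _ _).1 (filterI (filterI n1 n2) n3).
have uv0 : 0 < 1 + `|u| + `|v| by rewrite -addrA ltr_wpDr// addr_ge0.
(* The parallelogram of side [t] at [x] stays in the ball of radius [d]. *)
pose t : R := d / (1 + `|u| + `|v|).
have t0 : 0 < t by rewrite divr_gt0.
have td : t * (1 + `|u| + `|v|) = d by rewrite divfK// gt_eqF.
have inB (a b : R) : a \in `[0, t] -> b \in `[0, t] -> ball x d (x + a *: u + b *: v).
  rewrite !in_itv /= => /andP[a0 at_] /andP[b0 bt].
  rewrite -ball_normE /= -addrA opprD addNKr normrN.
  apply: (le_lt_trans (ler_normD _ _)); rewrite !normrZ !ger0_norm//.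
  apply: (@le_lt_trans _ _ (t * `|u| + t * `|v|)).
    by rewrite lerD// ler_wpM2r.
  by rewrite -td -mulrDr ltr_pM2l// -addrA ltrDr.
(* The same second difference is computed in both orders. *)
have [|a [b [a_in b_in ab]]] := @second_difference U f u v x t Cf t0.
  by move=> a b a_in b_in; exact: (dB _ (inB _ _ a_in b_in)).2.
have inB' (p q : R) : p \in `[0, t] -> q \in `[0, t] ->
    ball x d (x + p *: v + q *: u).
  by move=> ? ?; rewrite addrAC; apply: inB.
have [|a' [b' [a'_in b'_in ab']]] := @second_difference U f v u x t Cf t0.
  by move=> ? ? a'_in b'_in; exact: (dB _ (inB' _ _ a'_in b'_in)).2.
have E : 'D_v (fun y => 'D_u f y) (x + a *: u + b *: v) =
         'D_u (fun y => 'D_v f y) (x + a' *: v + b' *: u).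
  apply: (mulIf (lt0r_neq0 t0)); apply: (mulIf (lt0r_neq0 t0)).
  have swap (p q r s : R) : p - q - (r - s) = p - r - (q - s) by ring.
  apply: etrans (esym ab) _; apply: etrans _ ab'.
  rewrite [x + t *: v + _]addrAC.
  exact: swap.
have [[_ h1] _] := dB _ (inB _ _ a_in b_in).
have [[h2 _] _] := dB _ (inB' _ _ a'_in b'_in).
rewrite /= E in h1 h2.
apply: (le_trans (@ler_distD R R ('D_u (fun y => 'D_v f y) (x + a' *: v + b' *: u)) _ _)).
rewrite distrC in h2; rewrite (splitr e); exact: lerD h1 h2.
Qed.

End Scalar.
End Smooth.

(** * Vector fields as derivations *)

Section Derivations.
Context {R : realType} (M : set 'rV[R]_4).
Context (M_open : open M).
Implicit Types (X Y Z : @vector_field R) (f g : 'rV[R]_4 -> R) (x : 'rV[R]_4).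

Lemma smooth_cst (c : R) : smooth M (cst c).
Proof. by move=> n; exact: Cn_cst. Qed.

Lemma smooth_add f g : smooth M f -> smooth M g -> smooth M (fun x => f x + g x).
Proof. by move=> sf sg n; exact: Cn_add. Qed.

Lemma smooth_mul f g : smooth M f -> smooth M g -> smooth M (fun x => f x * g x).
Proof. by move=> sf sg n; exact: Cn_mul. Qed.

Lemma smooth_opp f : smooth M f -> smooth M (fun x => - f x).
Proof. by move=> sf n; exact: Cn_opp. Qed.

Lemma smooth_inv f : (forall x, M x -> f x != 0) -> smooth M f ->
  smooth M (fun x => (f x)^-1).
Proof. by move=> f0 sf n; exact: Cn_inv. Qed.

Lemma smooth_expR f : smooth M f -> smooth M (fun x => expR (f x)).
Proof. by move=> sf n; exact: Cn_expR. Qed.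

Lemma smooth_coordinate i : smooth M (fun x : 'rV[R]_4 => x 0 i).
Proof. by move=> n; exact: Cn_coordinate. Qed.

Lemma smooth_coord X i : smooth M X -> smooth M (fun x => X x 0 i).
Proof. by move=> sX n; exact: Cn_coord. Qed.

Lemma smooth_vector X : (forall i, smooth M (fun x => X x 0 i)) -> smooth M X.
Proof. by move=> sX n; apply: Cn_vector => // i; exact: sX. Qed.

Lemma smooth_eq (V : normedModType R) (f g : 'rV[R]_4 -> V) :
  (forall x, M x -> f x = g x) -> smooth M f -> smooth M g.
Proof. by move=> fg sf n; apply: Cn_eq (sf n). Qed.

Lemma smooth_derive f v : smooth M f -> smooth M (fun x => 'D_v f x).
Proof. by move=> sf n; exact: (sf n.+1).2. Qed.

Lemma smooth_diff (V : normedModType R) (f : 'rV[R]_4 -> V) x :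
  smooth M f -> M x -> differentiable f x.
Proof. by move=> sf; exact: (sf 1%N).1. Qed.

Lemma smooth_sum n (f : 'I_n -> 'rV[R]_4 -> R) :
  (forall i, smooth M (f i)) -> smooth M (fun x => \sum_(i < n) f i x).
Proof.
elim: n f => [|n IH] f sf.
  by apply: smooth_eq (smooth_cst 0) => x _; rewrite big_ord0.
apply: (@smooth_eq _ (fun x => \sum_(i < n) f (widen_ord (leqnSn n) i) x + f ord_max x)).
  by move=> x _; rewrite big_ord_recr.
by apply: smooth_add => //; apply: IH.
Qed.

Lemma deriv_along_eq X f g x : (forall y, M y -> f y = g y) -> M x ->
  deriv_along X f x = deriv_along X g x.
Proof. by move=> fg Mx; apply: near_eq_derive (eq_near_open M_open fg Mx). Qed.

Lemma deriv_alongD X f g x : smooth M f -> smooth M g -> M x ->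
  deriv_along X (fun y => f y + g y) x = deriv_along X f x + deriv_along X g x.
Proof.
move=> sf sg Mx; apply: (@deriveD _ _ _ f g); apply: diff_derivable;
  exact: smooth_diff.
Qed.

Lemma deriv_alongM X f g x : smooth M f -> smooth M g -> M x ->
  deriv_along X (fun y => f y * g y) x =
  deriv_along X f x * g x + f x * deriv_along X g x.
Proof.
move=> sf sg Mx; rewrite /deriv_along.
rewrite [LHS](@deriveM _ _ f g); try (apply: diff_derivable; exact: smooth_diff).
by rewrite addrC [_ *: _]mulrC.
Qed.

Lemma deriv_along_cst X (c : R) x : deriv_along X (fun=> c) x = 0.
Proof. exact: derive_cst. Qed.

Lemma deriv_alongN X f x : smooth M f -> M x ->
  deriv_along X (fun y => - f y) x = - deriv_along X f x.
Proof.
by move=> sf Mx; apply: (@deriveN _ _ _ f); apply: diff_derivable; exact: smooth_diff.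
Qed.

(** Reduces a derivative along a variable direction to constant ones, to which the
    definition of smoothness applies. *)
Lemma deriv_along_partial X f x : smooth M f -> M x ->
  deriv_along X f x = \sum_(i < 4) X x 0 i * partial i f x.
Proof.
move=> sf Mx; have df := smooth_diff sf Mx.
rewrite /partial /deriv_along deriveE// [in LHS](row_sum_delta (X x)) linear_sum.
by apply: eq_bigr => i _; rewrite linearZ /= deriveE.
Qed.

Lemma smooth_deriv_along X f : smooth M X -> smooth M f ->
  smooth M (deriv_along X f).
Proof.
move=> sX sf.
apply: (@smooth_eq _ (fun x => \sum_(i < 4) X x 0 i * partial i f x)).
  by move=> x Mx; rewrite deriv_along_partial.
apply: smooth_sum => i; apply: smooth_mul; first exact: smooth_coord.
exact: smooth_derive.
Qed.

Lemma derive_coord X Y x i : smooth M Y -> M x ->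
  ('D_(X x) Y x) 0 i = deriv_along X (fun y => Y y 0 i) x.
Proof.
by move=> sY Mx; rewrite derive_mx ?mxE//; apply: diff_derivable; exact: smooth_diff.
Qed.

Lemma deriv_along_sum X n (f : 'I_n -> 'rV[R]_4 -> R) x :
  (forall i, smooth M (f i)) -> M x ->
  deriv_along X (fun y => \sum_(i < n) f i y) x = \sum_(i < n) deriv_along X (f i) x.
Proof.
move=> sf Mx; rewrite -derive_sum.
  by rewrite /deriv_along; congr ('D__ _ x); apply/funext => y; rewrite fct_sumE.
by move=> i; apply: diff_derivable; exact: smooth_diff.
Qed.

(** Expanding [X(Y f)] gives first-order terms, which form the bracket, and second-order
    terms symmetric in [X] and [Y] by [derive_comm]. *)
Lemma lie_bracket_deriv X Y f x : smooth M X -> smooth M Y -> smooth M f -> M x ->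
  deriv_along (lie_bracket X Y) f x =
  deriv_along X (deriv_along Y f) x - deriv_along Y (deriv_along X f) x.
Proof.
move=> sX sY sf Mx.
have spf i : smooth M (partial i f) by exact: smooth_derive.
have E U V : smooth M U -> smooth M V -> deriv_along U (deriv_along V f) x =
    \sum_(i < 4) deriv_along U (fun y => V y 0 i) x * partial i f x +
    \sum_(i < 4) \sum_(j < 4) U x 0 j * V x 0 i * partial j (partial i f) x.
  move=> sU sV.
  rewrite (@deriv_along_eq U _ (fun y => \sum_(i < 4) V y 0 i * partial i f y))//;
    last by move=> y My; rewrite deriv_along_partial.
  rewrite deriv_along_sum//; last first.
    by move=> i; apply: smooth_mul => //; exact: smooth_coord.
  rewrite -big_split; apply: eq_bigr => i _ /=.
  rewrite deriv_alongM//; last exact: smooth_coord.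
  congr (_ + _); rewrite (deriv_along_partial _ (spf i) Mx) mulr_sumr.
  by apply: eq_bigr => j _; rewrite mulrA (mulrC (V x 0 i)).
rewrite !E// (deriv_along_partial _ sf Mx).
set A := \sum_(i < 4) \sum_(j < 4) X x 0 j * _ * _.
set B := \sum_(i < 4) \sum_(j < 4) Y x 0 j * _ * _.
have -> : A = B.
  rewrite /A /B exchange_big; apply: eq_bigr => i _; apply: eq_bigr => j _ /=.
  have -> : partial i (partial j f) x = partial j (partial i f) x.
    exact: derive_comm M_open (sf 2%N) Mx.
  exact: (congr1 (fun c => c * partial j (partial i f) x) (mulrC _ _)).
rewrite opprD addrACA subrr addr0 -sumrB; apply: eq_bigr => i _.
by rewrite /lie_bracket !mxE !derive_coord// mulrBl.
Qed.

End Derivations.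

(** * The metric and its inverse *)

Section Metric.
Context {R : realType}.
Implicit Types (X Y Z : @vector_field R) (f : 'rV[R]_4 -> R) (x : 'rV[R]_4).

Lemma ord4_cases (i : 'I_4) : [\/ i = 0, i = 1, i = 2 | i = 3].
Proof.
case: i => [[|[|[|[|//]]]] ?]; [apply: Or41|apply: Or42|apply: Or43|apply: Or44];
  exact/val_inj.
Qed.

Lemma sum_ord4 (V : nmodType) (F : 'I_4 -> V) :
  \sum_(i < 4) F i = F 0 + F 1 + F 2 + F 3.
Proof.
rewrite !big_ord_recr big_ord0 /= add0r.
by do 3?congr (_ + _); congr (F _); apply/val_inj.
Qed.

Lemma neq_ord4 : (((0 == 1 :> 'I_4) = false) * ((0 == 2 :> 'I_4) = false) *
  ((0 == 3 :> 'I_4) = false) * ((1 == 0 :> 'I_4) = false) *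
  ((1 == 2 :> 'I_4) = false) * ((1 == 3 :> 'I_4) = false) *
  ((2 == 0 :> 'I_4) = false) * ((2 == 1 :> 'I_4) = false) *
  ((2 == 3 :> 'I_4) = false) * ((3 == 0 :> 'I_4) = false) *
  ((3 == 1 :> 'I_4) = false) * ((3 == 2 :> 'I_4) = false))%type.
Proof. by []. Qed.

(** The components [F = g_11] and, below, [h = g_44] of the metric. *)
Definition exp13 : @scalar_field R := fun x => expR (x 0 0 + x 0 2).
Definition exp1 : @scalar_field R := fun x => expR (x 0 0).

Lemma exp1_neq0 x : exp1 x != 0. Proof. exact: lt0r_neq0 (expR_gt0 _). Qed.

Lemma smooth_exp13 (U : set 'rV[R]_4) : open U -> smooth U exp13.
Proof.
by move=> oU; apply: smooth_expR => //; apply: smooth_add => //; exact: smooth_coordinate.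
Qed.

Lemma smooth_exp1 (U : set 'rV[R]_4) : open U -> smooth U exp1.
Proof. move=> oU; apply: smooth_expR => //; exact: smooth_coordinate. Qed.

Lemma deriv_along_coordinate X i x : deriv_along X (fun y : 'rV[R]_4 => y 0 i) x = X x 0 i.
Proof.
have := derive_mx (@derivable_id _ _ x (X x)).
by move=> /(congr1 (fun A : 'rV[R]_4 => A 0 i)); rewrite derive_id mxE.
Qed.

Lemma deriv_along_exp13 X x : deriv_along X exp13 x = exp13 x * (X x 0 0 + X x 0 2).
Proof.
have sv (i : 'I_4) : smooth setT (fun y : 'rV[R]_4 => y 0 i) := smooth_coordinate _ i.
have s2 := smooth_add openT (sv 0) (sv 2).
have [+ _] := derive_expR_comp (X x) (smooth_diff s2 (I : [set: 'rV[R]_4] x)).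
rewrite /deriv_along => ->; congr (_ * _).
by rewrite [LHS](deriv_alongD X (sv 0) (sv 2))// !deriv_along_coordinate.
Qed.

Lemma deriv_along_exp1 X x : deriv_along X exp1 x = exp1 x * X x 0 0.
Proof.
have sv (i : 'I_4) : smooth setT (fun y : 'rV[R]_4 => y 0 i) := smooth_coordinate _ i.
have [+ _] := derive_expR_comp (X x) (smooth_diff (sv 0) (I : [set: 'rV[R]_4] x)).
by rewrite /deriv_along => ->; rewrite [X in _ * X]deriv_along_coordinate.
Qed.

(** Only [g_11 = F] and [g_44 = h] vary, and only with [x^1] and [x^3]. *)
Lemma partial_metric m i j x : partial m (fun y => the_metric y i j) x =
  ((i == 0) && (j == 0))%:R * (((m == 0)%:R + (m == 2)%:R) * exp13 x) +
  ((i == 3) && (j == 3))%:R * ((m == 0)%:R * exp1 x).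
Proof.
pose c : R := ((i == 0) && (j == 1))%:R + ((i == 1) && (j == 0))%:R
  + ((i == 2) && (j == 2))%:R.
have sc (r : R) : smooth setT (fun _ : 'rV[R]_4 => r) := smooth_cst _ r.
have -> : (fun y : 'rV[R]_4 => the_metric y i j) = (fun y =>
    ((i == 0) && (j == 0))%:R * exp13 y + (((i == 3) && (j == 3))%:R * exp1 y + c)).
  by apply/funext => y; rewrite /the_metric !mxE /c /exp13 /exp1; ring.
have s13 (r : R) : smooth setT (fun y => r * exp13 y) :=
  smooth_mul openT (sc r) (smooth_exp13 openT).
have s1 (r : R) : smooth setT (fun y => r * exp1 y) :=
  smooth_mul openT (sc r) (smooth_exp1 openT).
have xT : [set: 'rV[R]_4] x by [].
rewrite /partial (deriv_alongD _ (s13 _) (smooth_add openT (s1 _) (sc c)) xT).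
rewrite (deriv_alongD _ (s1 _) (sc c) xT).
rewrite (deriv_alongM _ (sc _) (smooth_exp13 openT) xT).
rewrite (deriv_alongM _ (sc _) (smooth_exp1 openT) xT) .
rewrite !deriv_along_cst !mul0r !add0r addr0 deriv_along_exp13 deriv_along_exp1.
rewrite /frame !mxE !eqxx /=.
by rewrite [exp13 x * _]mulrC [exp1 x * _]mulrC !(eq_sym _ m).
Qed.

Definition inverse_metric : @metric_field R := fun x =>
  delta_mx 0 1 + delta_mx 1 0 - exp13 x *: delta_mx 1 1 + delta_mx 2 2
  + (exp1 x)^-1 *: delta_mx 3 3.

Lemma mul_inverse_metric x : the_metric x *m inverse_metric x = 1%:M.
Proof.
apply/matrixP => i j; rewrite !mxE sum_ord4 !mxE -/(exp13 x) -/(exp1 x).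
have := exp1_neq0 x; move: (exp13 x) (exp1 x) => a b b0.
by case: (ord4_cases i) => ->; case: (ord4_cases j) => ->; rewrite !neq_ord4 /=; field.
Qed.

Lemma unitmx_the_metric x : the_metric x \in unitmx.
Proof. by have [] := mulmx1_unit (mul_inverse_metric x). Qed.

Lemma invmx_the_metric x : invmx (the_metric x) = inverse_metric x.
Proof. by rewrite -[LHS]mulmx1 -(mul_inverse_metric x) mulKmx ?unitmx_the_metric. Qed.

End Metric.

(** * Christoffel symbols *)

Section Connection.
Context {R : realType}.
Implicit Types (X Y Z : @vector_field R) (x u v : 'rV[R]_4).
Local Notation g := (@the_metric R).

(** The Christoffel part of [nabla]; the other part is the derivative of the components. *)
Definition gamma x u v (k : 'I_4) : R :=
  \sum_(i < 4) \sum_(j < 4) christoffel g k i j x * u 0 i * v 0 j.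

Lemma christoffelE k i j x : christoffel g k i j x =
  2^-1 * (inverse_metric x k 0 * (partial i (fun y => g y j 0) x +
             partial j (fun y => g y i 0) x - partial 0 (fun y => g y i j) x) +
          inverse_metric x k 1 * (partial i (fun y => g y j 1) x +
             partial j (fun y => g y i 1) x - partial 1 (fun y => g y i j) x) +
          inverse_metric x k 2 * (partial i (fun y => g y j 2) x +
             partial j (fun y => g y i 2) x - partial 2 (fun y => g y i j) x) +
          inverse_metric x k 3 * (partial i (fun y => g y j 3) x +
             partial j (fun y => g y i 3) x - partial 3 (fun y => g y i j) x)).
Proof. by rewrite /christoffel sum_ord4 invmx_the_metric. Qed.

Lemma christoffel_0 i j x : christoffel g 0 i j x = 0.
Proof.
rewrite christoffelE !partial_metric !mxE !neq_ord4 /= !andbF.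
move: (exp13 x) (exp1 x)^-1 (exp1 x) => a b c.
case: (ord4_cases i) => ->; case: (ord4_cases j) => ->;
  by rewrite !neq_ord4 ?eqxx /=; ring.
Qed.

Lemma christoffel_1 i j x : christoffel g 1 i j x =
  2^-1 * (((i == 0) && (j == 0))%:R + ((i == 0) && (j == 2))%:R +
     ((i == 2) && (j == 0))%:R) * exp13 x - 2^-1 * ((i == 3) && (j == 3))%:R * exp1 x.
Proof.
rewrite christoffelE !partial_metric !mxE !neq_ord4 /= !andbF !andbT.
have := exp1_neq0 x; move: (exp13 x) (exp1 x) => a b b0.
case: (ord4_cases i) => ->; case: (ord4_cases j) => ->;
  by rewrite !neq_ord4 ?eqxx /=; field; rewrite ?b0.
Qed.

Lemma christoffel_2 i j x : christoffel g 2 i j x =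
  - 2^-1 * ((i == 0) && (j == 0))%:R * exp13 x.
Proof.
rewrite christoffelE !partial_metric !mxE !neq_ord4 /= !andbF !andbT.
have := exp1_neq0 x; move: (exp13 x) (exp1 x) => a b b0.
case: (ord4_cases i) => ->; case: (ord4_cases j) => ->;
  by rewrite !neq_ord4 ?eqxx /=; field; rewrite ?b0.
Qed.

Lemma christoffel_3 i j x : christoffel g 3 i j x =
  2^-1 * (((i == 0) && (j == 3))%:R + ((i == 3) && (j == 0))%:R).
Proof.
rewrite christoffelE !partial_metric !mxE !neq_ord4 /= !andbF !andbT.
have := exp1_neq0 x; move: (exp13 x) (exp1 x) => a b b0.
case: (ord4_cases i) => ->; case: (ord4_cases j) => ->;
  by rewrite !neq_ord4 ?eqxx /=; field; rewrite ?b0.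
Qed.

(** The vanishing of all [Γ^1_ij] says that [dx^1] is parallel. *)
Lemma gamma_0 x u v : gamma x u v 0 = 0.
Proof.
rewrite /gamma; apply: big1 => i _; apply: big1 => j _.
by rewrite christoffel_0 !mul0r.
Qed.

Lemma gamma_1 x u v : gamma x u v 1 =
  2^-1 * exp13 x * (u 0 0 * v 0 0 + u 0 0 * v 0 2 + u 0 2 * v 0 0)
  - 2^-1 * exp1 x * u 0 3 * v 0 3.
Proof.
rewrite /gamma !sum_ord4 !christoffel_1 !neq_ord4 !eqxx /=.
move: (exp13 x) (exp1 x) (u 0 0) (u 0 1) (u 0 2) (u 0 3) (v 0 0) (v 0 1) (v 0 2) (v 0 3).
by move=> a b u0 u1 u2 u3 v0 v1 v2 v3; field.
Qed.

Lemma gamma_2 x u v : gamma x u v 2 = - 2^-1 * exp13 x * u 0 0 * v 0 0.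
Proof.
rewrite /gamma !sum_ord4 !christoffel_2 !neq_ord4 !eqxx /=.
move: (exp13 x) (exp1 x) (u 0 0) (u 0 1) (u 0 2) (u 0 3) (v 0 0) (v 0 1) (v 0 2) (v 0 3).
by move=> a b u0 u1 u2 u3 v0 v1 v2 v3; field.
Qed.

Lemma gamma_3 x u v : gamma x u v 3 = 2^-1 * (u 0 0 * v 0 3 + u 0 3 * v 0 0).
Proof.
rewrite /gamma !sum_ord4 !christoffel_3 !neq_ord4 !eqxx /=.
move: (u 0 0) (u 0 1) (u 0 2) (u 0 3) (v 0 0) (v 0 1) (v 0 2) (v 0 3).
by move=> u0 u1 u2 u3 v0 v1 v2 v3; field.
Qed.

Lemma nabla_gamma X Y x k :
  nabla g X Y x 0 k = 'D_(X x) Y x 0 k + gamma x (X x) (Y x) k.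
Proof. by rewrite /nabla mxE [X in _ + X]mxE. Qed.

Lemma nabla_0 X Y x : nabla g X Y x 0 0 = 'D_(X x) Y x 0 0.
Proof. by rewrite nabla_gamma gamma_0 addr0. Qed.

Lemma nabla_2 X Y x :
  nabla g X Y x 0 2 = 'D_(X x) Y x 0 2 - 2^-1 * exp13 x * X x 0 0 * Y x 0 0.
Proof. by rewrite nabla_gamma gamma_2 !mulNr. Qed.

Lemma nabla_3 X Y x : nabla g X Y x 0 3 =
  'D_(X x) Y x 0 3 + 2^-1 * (X x 0 0 * Y x 0 3 + X x 0 3 * Y x 0 0).
Proof. by rewrite nabla_gamma gamma_3. Qed.

Lemma nabla_coord (M : set 'rV[R]_4) X Y k x : smooth M Y -> M x ->
  nabla g X Y x 0 k = deriv_along X (fun y => Y y 0 k) x + gamma x (X x) (Y x) k.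
Proof. by move=> sY Mx; rewrite nabla_gamma (derive_coord X _ sY Mx). Qed.

End Connection.

(** * The curvature operator *)

Ltac prove_smooth :=
  repeat first
    [ assumption
    | apply: smooth_exp13 | apply: smooth_exp1
    | apply: smooth_coord
    | apply: smooth_deriv_along
    | exact: smooth_cst
    | apply: smooth_add | apply: smooth_mul | apply: smooth_opp ].

Section Curvature.
Context {R : realType} (M : set 'rV[R]_4).
Context (M_open : open M).
Implicit Types (X Y Z : @vector_field R) (x u v : 'rV[R]_4).
Local Notation g := (@the_metric R).

Ltac expand_deriv :=
  rewrite ?(@deriv_alongD _ M, @deriv_alongM _ M, @deriv_alongN _ M,
    deriv_along_cst, deriv_along_exp13, deriv_along_exp1); try prove_smooth.

Lemma smooth_gamma Y Z k : smooth M Y -> smooth M Z ->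
  smooth M (fun y => gamma y (Y y) (Z y) k).
Proof.
move=> sY sZ; case: (ord4_cases k) => ->.
- by apply: (smooth_eq M_open (fun y _ => esym (gamma_0 y (Y y) (Z y)))); prove_smooth.
- by apply: (smooth_eq M_open (fun y _ => esym (gamma_1 y (Y y) (Z y)))); prove_smooth.
- by apply: (smooth_eq M_open (fun y _ => esym (gamma_2 y (Y y) (Z y)))); prove_smooth.
- by apply: (smooth_eq M_open (fun y _ => esym (gamma_3 y (Y y) (Z y)))); prove_smooth.
Qed.

Lemma smooth_nabla X Y : smooth M X -> smooth M Y -> smooth M (nabla g X Y).
Proof.
move=> sX sY; apply: smooth_vector => // k.
apply: (smooth_eq M_open (fun y My => esym (nabla_coord X k sY My))).
by apply: smooth_add => //; [prove_smooth|exact: smooth_gamma].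
Qed.

Lemma lie_bracket_coord X Y x k :
  lie_bracket X Y x 0 k = 'D_(X x) Y x 0 k - 'D_(Y x) X x 0 k.
Proof. by rewrite /lie_bracket mxE [X in _ + X]mxE. Qed.

Local Opaque derive deriv_along nabla lie_bracket gamma exp1 exp13.

Ltac generalize_atoms :=
  repeat match goal with
  | |- context [deriv_along ?X ?f ?x] => generalize (deriv_along X f x); intro
  end;
  repeat match goal with
  | |- context [fun_of_matrix ?A ?i ?j] => generalize (fun_of_matrix A i j); intro
  end;
  repeat match goal with
  | |- context [exp13 ?x] => generalize (exp13 x); intro
  | |- context [exp1 ?x] => generalize (exp1 x); intro
  end.

(** Leibniz rule: the last two terms differentiate the Christoffel symbols. *)
Lemma deriv_gamma_1 X Y Z x : smooth M X -> smooth M Y -> smooth M Z -> M x ->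
  deriv_along X (fun y => gamma y (Y y) (Z y) 1) x =
  gamma x ('D_(X x) Y x) (Z x) 1 + gamma x (Y x) ('D_(X x) Z x) 1
  + 2^-1 * exp13 x * (X x 0 0 + X x 0 2) *
      (Y x 0 0 * Z x 0 0 + Y x 0 0 * Z x 0 2 + Y x 0 2 * Z x 0 0)
  - 2^-1 * exp1 x * X x 0 0 * Y x 0 3 * Z x 0 3.
Proof.
move=> sX sY sZ Mx.
rewrite (deriv_along_eq M_open X (fun y _ => gamma_1 y (Y y) (Z y)) Mx).
rewrite !gamma_1 !(derive_coord X _ _ Mx)//.
expand_deriv; generalize_atoms; ring.
Qed.

Lemma deriv_gamma_2 X Y Z x : smooth M X -> smooth M Y -> smooth M Z -> M x ->
  deriv_along X (fun y => gamma y (Y y) (Z y) 2) x =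
  gamma x ('D_(X x) Y x) (Z x) 2 + gamma x (Y x) ('D_(X x) Z x) 2
  - 2^-1 * exp13 x * (X x 0 0 + X x 0 2) * (Y x 0 0 * Z x 0 0).
Proof.
move=> sX sY sZ Mx.
rewrite (deriv_along_eq M_open X (fun y _ => gamma_2 y (Y y) (Z y)) Mx).
rewrite !gamma_2 !(derive_coord X _ _ Mx)//.
expand_deriv; generalize_atoms; ring.
Qed.

Lemma deriv_gamma_3 X Y Z x : smooth M X -> smooth M Y -> smooth M Z -> M x ->
  deriv_along X (fun y => gamma y (Y y) (Z y) 3) x =
  gamma x ('D_(X x) Y x) (Z x) 3 + gamma x (Y x) ('D_(X x) Z x) 3.
Proof.
move=> sX sY sZ Mx.
rewrite (deriv_along_eq M_open X (fun y _ => gamma_3 y (Y y) (Z y)) Mx).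
rewrite !gamma_3 !(derive_coord X _ _ Mx)//.
expand_deriv; generalize_atoms; ring.
Qed.

(** The 2-form [dx^1 ∧ dx^(i+1)]. *)
Definition minor (i : 'I_4) X Y : @scalar_field R :=
  fun x => X x 0 0 * Y x 0 i - X x 0 i * Y x 0 0.

Lemma nabla_nabla_coord X Y Z k x : smooth M X -> smooth M Y -> smooth M Z -> M x ->
  nabla g X (nabla g Y Z) x 0 k =
  deriv_along X (deriv_along Y (fun y => Z y 0 k)) x
  + deriv_along X (fun y => gamma y (Y y) (Z y) k) x
  + gamma x (X x) (nabla g Y Z x) k.
Proof.
move=> sX sY sZ Mx; rewrite (nabla_coord X k (smooth_nabla sY sZ) Mx); congr (_ + _).
rewrite (deriv_along_eq M_open X (fun y My => nabla_coord Y k sZ My) Mx).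
by apply: deriv_alongD Mx; [prove_smooth|exact: smooth_gamma].
Qed.

(** The second derivatives of [Z] cancel against the derivative along the bracket, by
    [lie_bracket_deriv]. *)
Lemma curvature_op_coord X Y Z k x : smooth M X -> smooth M Y -> smooth M Z -> M x ->
  curvature_op g X Y Z x 0 k =
  deriv_along X (fun y => gamma y (Y y) (Z y) k) x
  - deriv_along Y (fun y => gamma y (X y) (Z y) k) x
  + gamma x (X x) (nabla g Y Z x) k - gamma x (Y x) (nabla g X Z x) k
  - gamma x (lie_bracket X Y x) (Z x) k.
Proof.
move=> sX sY sZ Mx; rewrite /curvature_op mxE [X in _ + X]mxE mxE [X in _ + X - _]mxE.
rewrite (nabla_nabla_coord k sX sY sZ Mx) (nabla_nabla_coord k sY sX sZ Mx).
rewrite (nabla_coord _ k sZ Mx) (lie_bracket_deriv M_open sX sY (smooth_coord M_open k sZ) Mx).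
generalize_atoms; repeat match goal with
  | |- context [gamma ?x ?u ?v ?i] => generalize (gamma x u v i); intro
  end; ring.
Qed.

Lemma curvature_op_0 X Y Z x : smooth M X -> smooth M Y -> smooth M Z -> M x ->
  curvature_op g X Y Z x 0 0 = 0.
Proof.
move=> sX sY sZ Mx; rewrite (curvature_op_coord 0 sX sY sZ Mx) !gamma_0 !subr0 addr0.
rewrite !(deriv_along_eq M_open _ (fun y _ => gamma_0 y _ _) Mx).
by rewrite !deriv_along_cst subrr.
Qed.

Ltac generalize_vectors X Y Z x :=
  move: (nabla_0 X Z x) (nabla_2 X Z x) (nabla_3 X Z x)
    (nabla_0 Y Z x) (nabla_2 Y Z x) (nabla_3 Y Z x) (lie_bracket_coord X Y x);
  move: (X x) (Y x) (Z x) ('D_(X x) Y x) ('D_(Y x) X x) ('D_(X x) Z x) ('D_(Y x) Z x)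
    (nabla g X Z x) (nabla g Y Z x) (lie_bracket X Y x) (exp13 x) (exp1 x).

Lemma curvature_op_1 X Y Z x : smooth M X -> smooth M Y -> smooth M Z -> M x ->
  curvature_op g X Y Z x 0 1 =
  - (2^-1 * exp13 x * minor 2 X Y x * Z x 0 2 + 4^-1 * exp1 x * minor 3 X Y x * Z x 0 3).
Proof.
move=> sX sY sZ Mx; rewrite (curvature_op_coord 1 sX sY sZ Mx).
rewrite (deriv_gamma_1 sX sY sZ Mx) (deriv_gamma_1 sY sX sZ Mx) !gamma_1 /minor.
generalize_vectors X Y Z x.
move=> u v w a b c d n m l F h -> -> -> -> -> -> lE; by rewrite !lE; field.
Qed.

Lemma curvature_op_2 X Y Z x : smooth M X -> smooth M Y -> smooth M Z -> M x ->
  curvature_op g X Y Z x 0 2 = 2^-1 * exp13 x * minor 2 X Y x * Z x 0 0.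
Proof.
move=> sX sY sZ Mx; rewrite (curvature_op_coord 2 sX sY sZ Mx).
rewrite (deriv_gamma_2 sX sY sZ Mx) (deriv_gamma_2 sY sX sZ Mx) !gamma_2 /minor.
generalize_vectors X Y Z x.
move=> u v w a b c d n m l F h -> _ _ -> _ _ lE; by rewrite !lE; field.
Qed.

Lemma curvature_op_3 X Y Z x : smooth M X -> smooth M Y -> smooth M Z -> M x ->
  curvature_op g X Y Z x 0 3 = 4^-1 * minor 3 X Y x * Z x 0 0.
Proof.
move=> sX sY sZ Mx; rewrite (curvature_op_coord 3 sX sY sZ Mx).
rewrite (deriv_gamma_3 sX sY sZ Mx) (deriv_gamma_3 sY sX sZ Mx) !gamma_3 /minor.
generalize_vectors X Y Z x.
move=> u v w a b c d n m l F h -> _ -> -> _ -> lE; by rewrite !lE; field.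
Qed.

End Curvature.

(** * Curvature tensors in normal form *)

Section CurvatureTensors.
Context {R : realType} (M : set 'rV[R]_4).
Context (M_open : open M).
Implicit Types (X Y Z V : @vector_field R) (x : 'rV[R]_4) (p q : @scalar_field R).
Local Notation g := (@the_metric R).

Local Opaque derive deriv_along nabla lie_bracket curvature_op.

(** The Kulkarni-Nomizu product of [- dx^1 ⊗ dx^1] with [p (dx^3)^2 + q h (dx^4)^2].  The
    factor [h = g_44] makes the tensor parallel when [p] and [q] are constant. *)
Definition pp_wave p q : tensor4 := fun X1 X2 X3 X4 x =>
  p x * minor 2 X1 X2 x * minor 2 X3 X4 x
  + q x * exp1 x * minor 3 X1 X2 x * minor 3 X3 X4 x.

(** The Ricci tensor is [- ricci_coef dx^1 ⊗ dx^1]. *)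
Definition ricci_coef : @scalar_field R := fun x => 4^-1 * (2 * exp13 x + 1).
(** Half the difference of the two coefficients [F/2] and [1/4] of the curvature tensor:
    removing the trace of [pp_wave p q] replaces both by plus or minus [(p - q)/2]. *)
Definition weyl_coef : @scalar_field R := fun x => 8^-1 * (2 * exp13 x - 1).

Definition weyl_wave : tensor4 := pp_wave weyl_coef (fun x => - weyl_coef x).

Lemma metricE X Y x : metric g X Y x =
  exp13 x * X x 0 0 * Y x 0 0 + (X x 0 0 * Y x 0 1 + X x 0 1 * Y x 0 0)
  + X x 0 2 * Y x 0 2 + exp1 x * X x 0 3 * Y x 0 3.
Proof. exact: the_metricE. Qed.

Lemma frameE i j x : frame i x 0 j = (j == i)%:R :> R.
Proof. by rewrite /frame mxE eqxx. Qed.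

Lemma smooth_frame i : smooth M (frame i : @vector_field R).
Proof. by move=> n; exact: Cn_cst. Qed.

Lemma trace_inverse (T : 'I_4 -> 'I_4 -> R) x :
  \sum_(i < 4) \sum_(j < 4) invmx (g x) i j * T i j =
  T 0 1 + T 1 0 - exp13 x * T 1 1 + T 2 2 + (exp1 x)^-1 * T 3 3.
Proof.
rewrite !sum_ord4 invmx_the_metric /inverse_metric !mxE !neq_ord4 !eqxx /=.
move: (exp13 x) (exp1 x)^-1 => a b; ring.
Qed.

Lemma riemannE X1 X2 X3 X4 x :
  smooth M X1 -> smooth M X2 -> smooth M X3 -> M x ->
  riemann g X1 X2 X3 X4 x =
  pp_wave (fun x => 2^-1 * exp13 x) (fun=> 4^-1) X1 X2 X3 X4 x.
Proof.
move=> s1 s2 s3 Mx; rewrite /riemann metricE /pp_wave.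
rewrite (curvature_op_0 M_open s1 s2 s3 Mx) (curvature_op_1 M_open s1 s2 s3 Mx).
rewrite (curvature_op_2 M_open s1 s2 s3 Mx) (curvature_op_3 M_open s1 s2 s3 Mx).
rewrite [minor 2 X3 X4 x]/minor [minor 3 X3 X4 x]/minor.
move: (minor 2 X1 X2 x) (minor 3 X1 X2 x) (X3 x) (X4 x) (exp13 x) (exp1 x).
by move=> a b u v F h; field.
Qed.

(** In the trace of [riemannE] only [g^33 = 1] and [g^44 = 1/h] contribute, each with one
    of the two squares. *)
Lemma ricciE X Y x : smooth M X -> smooth M Y -> M x ->
  ricci g X Y x = - ricci_coef x * X x 0 0 * Y x 0 0.
Proof.
move=> sX sY Mx; rewrite /ricci trace_inverse !riemannE//; try exact: smooth_frame.
rewrite /pp_wave /minor !frameE !neq_ord4 !eqxx /ricci_coef /=.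
have := exp1_neq0 x; move: (X x) (Y x) (exp13 x) (exp1 x) => u v F h h0.
by field; rewrite ?h0.
Qed.

(** The covector [dx^1] is null: [g^11 = 0]. *)
Lemma scalE x : M x -> scal g x = 0.
Proof.
move=> Mx; rewrite /scal trace_inverse !ricciE//; try exact: smooth_frame.
rewrite !frameE !neq_ord4 !eqxx; move: (ricci_coef x) (exp13 x) (exp1 x)^-1 => a b c.
by rewrite !(mulr0, mulr1, addr0, subr0).
Qed.

Section Fields.
Context (X1 X2 X3 X4 : @vector_field R) (x : 'rV[R]_4).
Context (s1 : smooth M X1) (s2 : smooth M X2) (s3 : smooth M X3)
  (s4 : smooth M X4) (Mx : M x).

(** The Ricci tensor is a multiple of [dx^1 ⊗ dx^1], so the entries of [g] that involve
    [dx^1] cancel by antisymmetry. *)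
Lemma kulkarni_nomizuE :
  kulkarni_nomizu (metric g) (ricci g) X1 X2 X3 X4 x = pp_wave ricci_coef ricci_coef X1 X2 X3 X4 x.
Proof.
rewrite /kulkarni_nomizu !ricciE// !metricE /pp_wave /minor.
move: (X1 x) (X2 x) (X3 x) (X4 x) (exp13 x) (exp1 x) (ricci_coef x) => u v w t F h s; ring.
Qed.

Lemma kulkarni_nomizuC (J F : @tensor2 R) :
  kulkarni_nomizu J F X1 X2 X3 X4 x = kulkarni_nomizu F J X1 X2 X3 X4 x.
Proof.
rewrite /kulkarni_nomizu.
move: (J X1 X4 x) (J X2 X3 x) (J X1 X3 x) (J X2 X4 x) => a b c d.
move: (F X1 X4 x) (F X2 X3 x) (F X1 X3 x) (F X2 X4 x) => a' b' c' d'; ring.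
Qed.

Lemma conharmonicE :
  conharmonic g X1 X2 X3 X4 x = weyl_wave X1 X2 X3 X4 x.
Proof.
rewrite /conharmonic kulkarni_nomizuE riemannE// /weyl_wave /pp_wave /weyl_coef /ricci_coef.
move: (minor 2 X1 X2 x) (minor 3 X1 X2 x) (minor 2 X3 X4 x) (minor 3 X3 X4 x)
  (exp13 x) (exp1 x) => a b c d F h.
rewrite (_ : (4 : R) - 2 = 2); last by ring.
by field.
Qed.

Lemma conformalE : conformal g X1 X2 X3 X4 x = conharmonic g X1 X2 X3 X4 x.
Proof. by rewrite /conformal scalE// !mul0r addr0. Qed.

Lemma concircularE : concircular g X1 X2 X3 X4 x = riemann g X1 X2 X3 X4 x.
Proof. by rewrite /concircular scalE// !mul0r subr0. Qed.

End Fields.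

(** Nondegeneracy of [g]. *)
Lemma raise_metric (H : @tensor4 R) X Y Z V x :
  (forall i, H X Y Z (frame i) x = metric g V (frame i) x) -> raise g H X Y Z x = V x.
Proof.
move=> HV; rewrite /raise.
rewrite (_ : \row_i _ = V x *m g x) ?mulmxK ?unitmx_the_metric//.
apply/rowP => i; rewrite !mxE HV /metric; apply: eq_bigr => j _.
rewrite (bigD1 i)//= big1 ?addr0; last by move=> k ki; rewrite frameE (negPf ki) mulr0.
by rewrite frameE eqxx mulr1 mulrC.
Qed.

Lemma raise_riemann X Y Z : raise g (riemann g) X Y Z = curvature_op g X Y Z.
Proof. by apply/funext => x; exact: raise_metric. Qed.

(** The correction term of the projective tensor is
    [g(S(X2, X3) X1 - S(X1, X3) X2, X4) / 3]. *)
Lemma raise_projective X Y Z : raise g (projective g) X Y Z =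
  fun x => curvature_op g X Y Z x - 3^-1 *: wedge_op (ricci g) X Y Z x.
Proof.
apply/funext => x; apply: (@raise_metric _ X Y Z
  (fun x => curvature_op g X Y Z x - 3^-1 *: wedge_op (ricci g) X Y Z x)) => i.
rewrite /projective /riemann /wedge_op !metricE.
rewrite (_ : (4 : R) - 1 = 3); last by ring.
move: (curvature_op g X Y Z x) (ricci g Y Z x) (ricci g X Z x) (X x) (Y x)
  (frame i x) (exp13 x) (exp1 x) => r a b u v w F h.
by rewrite !mxE; ring.
Qed.

Lemma smooth_curvature_op X Y Z : smooth M X -> smooth M Y -> smooth M Z ->
  smooth M (curvature_op g X Y Z).
Proof.
move=> sX sY sZ.
have sm i : smooth M (minor i X Y) by rewrite /minor; prove_smooth.
apply: smooth_vector => // k; case: (ord4_cases k) => ->.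
- by apply: (smooth_eq M_open (fun y My => esym (curvature_op_0 M_open sX sY sZ My))); prove_smooth.
- by apply: (smooth_eq M_open (fun y My => esym (curvature_op_1 M_open sX sY sZ My))); prove_smooth.
- by apply: (smooth_eq M_open (fun y My => esym (curvature_op_2 M_open sX sY sZ My))); prove_smooth.
- by apply: (smooth_eq M_open (fun y My => esym (curvature_op_3 M_open sX sY sZ My))); prove_smooth.
Qed.

Lemma smooth_ricci_coef : smooth M ricci_coef.
Proof. by rewrite /ricci_coef; prove_smooth. Qed.

Lemma smooth_weyl_coef : smooth M weyl_coef.
Proof. by rewrite /weyl_coef; prove_smooth. Qed.

Lemma smooth_wedge_ricci X Y Z : smooth M X -> smooth M Y -> smooth M Z ->
  smooth M (wedge_op (ricci g) X Y Z).
Proof.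
move=> sX sY sZ; have ss := smooth_ricci_coef.
have sS U : smooth M U -> smooth M (fun y => ricci g U Z y).
  by move=> sU; apply: (smooth_eq M_open (fun y My => esym (ricciE sU sZ My))); prove_smooth.
apply: smooth_vector => // k.
have sE : smooth M (fun y => ricci g Y Z y * X y 0 k + - (ricci g X Z y * Y y 0 k)).
  exact: (smooth_add M_open (smooth_mul M_open (sS _ sY) (smooth_coord M_open k sX))
    (smooth_opp M_open (smooth_mul M_open (sS _ sX) (smooth_coord M_open k sY)))).
apply: (smooth_eq M_open _ sE) => y _; rewrite /wedge_op.
by move: (X y) (Y y) (ricci g _ _ y) (ricci g _ _ y) => u v a b; rewrite !mxE.
Qed.

(** [R(X, Y)] kills [dx^1 ∧ dx^3] and [dx^1 ∧ dx^4] as a derivation: [R(X, Y) Z] has no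
    [∂_1] component, and its [∂_3] and [∂_4] components are proportional to [dx^1(Z)], with
    factors independent of [Z]. *)
Lemma minor_curvature_op X Y Z V i x :
  smooth M X -> smooth M Y -> smooth M Z -> smooth M V -> M x -> (i == 2) || (i == 3) ->
  minor i (curvature_op g X Y Z) V x = - minor i Z (curvature_op g X Y V) x.
Proof.
move=> sX sY sZ sV Mx i23; rewrite /minor.
rewrite (curvature_op_0 M_open sX sY sZ Mx) (curvature_op_0 M_open sX sY sV Mx).
case/orP: i23 => /eqP ->.
  rewrite (curvature_op_2 M_open sX sY sZ Mx) (curvature_op_2 M_open sX sY sV Mx).
  by move: (minor _ X Y x) (Z x) (V x) (exp13 x) => m u v F; ring.
rewrite (curvature_op_3 M_open sX sY sZ Mx) (curvature_op_3 M_open sX sY sV Mx).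
by move: (minor _ X Y x) (Z x) (V x) (exp13 x) => m u v F; ring.
Qed.

Lemma metric_curvature_op X Y Z V x :
  smooth M X -> smooth M Y -> smooth M Z -> smooth M V -> M x ->
  metric g (curvature_op g X Y Z) V x = - metric g Z (curvature_op g X Y V) x.
Proof.
move=> sX sY sZ sV Mx.
rewrite !metricE.
rewrite (curvature_op_0 M_open sX sY sZ Mx) (curvature_op_1 M_open sX sY sZ Mx).
rewrite (curvature_op_2 M_open sX sY sZ Mx) (curvature_op_3 M_open sX sY sZ Mx).
rewrite (curvature_op_0 M_open sX sY sV Mx) (curvature_op_1 M_open sX sY sV Mx).
rewrite (curvature_op_2 M_open sX sY sV Mx) (curvature_op_3 M_open sX sY sV Mx).
move: (minor 2 X Y x) (minor 3 X Y x) (Z x) (V x) (exp13 x) (exp1 x) => m n u v F h.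
by field.
Qed.

(** * Covariant derivatives *)

Section Covariant.
Context (X Y Z : @vector_field R) (x : 'rV[R]_4).
Context (sX : smooth M X) (sY : smooth M Y) (sZ : smooth M Z) (Mx : M x).

Lemma deriv_along_dx1 : deriv_along X (fun y => Y y 0 0) x = nabla g X Y x 0 0.
Proof. by rewrite nabla_0 (derive_coord X _ sY Mx). Qed.

Lemma deriv_along_minor i : deriv_along X (minor i Y Z) x =
  'D_(X x) Y x 0 0 * Z x 0 i + Y x 0 0 * 'D_(X x) Z x 0 i
  - ('D_(X x) Y x 0 i * Z x 0 0 + Y x 0 i * 'D_(X x) Z x 0 0).
Proof.
rewrite /minor !(derive_coord X _ sY Mx) !(derive_coord X _ sZ Mx).
have c (V : @vector_field R) k : smooth M V -> smooth M (fun y => V y 0 k) :=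
  fun sV => smooth_coord M_open k sV.
have cm (V W : @vector_field R) k l : smooth M V -> smooth M W ->
    smooth M (fun y => V y 0 k * W y 0 l).
  by move=> sV sW; apply: smooth_mul => //; apply: c.
rewrite (deriv_alongD _ (cm _ _ _ _ sY sZ) (smooth_opp M_open (cm _ _ _ _ sY sZ)) Mx).
rewrite (deriv_alongN _ (cm _ _ _ _ sY sZ) Mx).
by rewrite !(deriv_alongM _ (c _ _ sY) (c _ _ sZ) Mx).
Qed.

(** [dx^1 ∧ dx^3] is parallel: [∇ dx^3] is a multiple of [dx^1 ⊗ dx^1]. *)
Lemma deriv_along_minor2 : deriv_along X (minor 2 Y Z) x =
  minor 2 (nabla g X Y) Z x + minor 2 Y (nabla g X Z) x.
Proof.
rewrite deriv_along_minor /minor.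
move: (nabla_0 X Y x) (nabla_2 X Y x) (nabla_0 X Z x) (nabla_2 X Z x).
move: (X x) (Y x) (Z x) ('D_(X x) Y x) ('D_(X x) Z x) (nabla g X Y x) (nabla g X Z x) (exp13 x).
by move=> u v w a b c d F -> -> -> ->; ring.
Qed.

(** [∇ dx^4 = - 1/2 (dx^1 ⊗ dx^4 + dx^4 ⊗ dx^1)], and wedging with [dx^1] leaves one of the
    two terms. *)
Lemma deriv_along_minor3 : deriv_along X (minor 3 Y Z) x =
  minor 3 (nabla g X Y) Z x + minor 3 Y (nabla g X Z) x
  - 2^-1 * X x 0 0 * minor 3 Y Z x.
Proof.
rewrite deriv_along_minor /minor.
move: (nabla_0 X Y x) (nabla_3 X Y x) (nabla_0 X Z x) (nabla_3 X Z x).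
move: (X x) (Y x) (Z x) ('D_(X x) Y x) ('D_(X x) Z x) (nabla g X Y x) (nabla g X Z x).
by move=> u v w a b c d -> -> -> ->; field.
Qed.

End Covariant.

(** The slots of a covariant derivative are filled with [∇_X X_i], which are smooth too, so
    an equality of tensors on smooth fields can be differentiated. *)
Lemma cov4_eq (T T' : @tensor4 R) X X1 X2 X3 X4 x :
  eq4 M M T T' ->
  smooth M X -> smooth M X1 -> smooth M X2 -> smooth M X3 -> smooth M X4 -> M x ->
  cov4 g T X X1 X2 X3 X4 x = cov4 g T' X X1 X2 X3 X4 x.
Proof.
move=> TT' sX s1 s2 s3 s4 Mx; have sn V : smooth M V -> smooth M (nabla g X V).
  exact: smooth_nabla.
rewrite /cov4 (deriv_along_eq M_open X (TT' _ _ _ _ s1 s2 s3 s4) Mx).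
by rewrite !TT'//; exact: sn.
Qed.

(** The derivative [X(h) = h dx^1(X)] cancels the two contributions [- 1/2 dx^1(X)] of the
    factors [dx^1 ∧ dx^4]. *)
Lemma cov4_wave p q X X1 X2 X3 X4 x : smooth M p -> smooth M q ->
  smooth M X -> smooth M X1 -> smooth M X2 -> smooth M X3 -> smooth M X4 -> M x ->
  cov4 g (pp_wave p q) X X1 X2 X3 X4 x =
  pp_wave (deriv_along X p) (deriv_along X q) X1 X2 X3 X4 x.
Proof.
move=> sp sq sX s1 s2 s3 s4 Mx; rewrite /cov4.
have sm i V W : smooth M V -> smooth M W -> smooth M (minor i V W).
  by move=> sV sW; rewrite /minor; prove_smooth.
have se1 : smooth M (@exp1 R) := smooth_exp1 M_open.
have spm := smooth_mul M_open sp (sm 2 _ _ s1 s2).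
have sqe := smooth_mul M_open sq se1.
have sqm := smooth_mul M_open sqe (sm 3 _ _ s1 s2).
have -> : deriv_along X (pp_wave p q X1 X2 X3 X4) x =
  deriv_along X p x * minor 2 X1 X2 x * minor 2 X3 X4 x
  + p x * deriv_along X (minor 2 X1 X2) x * minor 2 X3 X4 x
  + p x * minor 2 X1 X2 x * deriv_along X (minor 2 X3 X4) x
  + (deriv_along X q x * exp1 x + q x * deriv_along X (@exp1 R) x)
      * minor 3 X1 X2 x * minor 3 X3 X4 x
  + q x * exp1 x * deriv_along X (minor 3 X1 X2) x * minor 3 X3 X4 x
  + q x * exp1 x * minor 3 X1 X2 x * deriv_along X (minor 3 X3 X4) x.
  rewrite (deriv_alongD _ (smooth_mul M_open spm (sm 2 _ _ s3 s4))
    (smooth_mul M_open sqm (sm 3 _ _ s3 s4)) Mx).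
  rewrite (deriv_alongM _ spm (sm 2 _ _ s3 s4) Mx) (deriv_alongM _ sqm (sm 3 _ _ s3 s4) Mx).
  rewrite (deriv_alongM _ sp (sm 2 _ _ s1 s2) Mx) (deriv_alongM _ sqe (sm 3 _ _ s1 s2) Mx).
  rewrite (deriv_alongM _ sq se1 Mx).
  move: (deriv_along X p x) (deriv_along X q x) (deriv_along X (@exp1 R) x)
    (deriv_along X (minor 2 X1 X2) x) (deriv_along X (minor 3 X1 X2) x)
    (deriv_along X (minor 2 X3 X4) x) (deriv_along X (minor 3 X3 X4) x) => a b c d e f h.
  move: (minor 2 X1 X2 x) (minor 3 X1 X2 x) (minor 2 X3 X4 x) (minor 3 X3 X4 x)
    (p x) (q x) (exp1 x) => i j k l m n o; ring.
rewrite !deriv_along_minor2// !deriv_along_minor3// deriv_along_exp1 /pp_wave.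
move: (minor 2 X1 X2 x) (minor 3 X1 X2 x) (minor 2 X3 X4 x) (minor 3 X3 X4 x) => a b c d.
move: (minor 2 (nabla g X X1) X2 x) (minor 3 (nabla g X X1) X2 x)
  (minor 2 (nabla g X X3) X4 x) (minor 3 (nabla g X X3) X4 x) => a1 b1 c1 d1.
move: (minor 2 X1 (nabla g X X2) x) (minor 3 X1 (nabla g X X2) x)
  (minor 2 X3 (nabla g X X4) x) (minor 3 X3 (nabla g X X4) x) => a2 b2 c2 d2.
move: (deriv_along X p x) (deriv_along X q x) (p x) (q x) (exp1 x) (X x) => dp dq i j h u.
by field.
Qed.

Lemma deriv_along_ricci_coef X x : M x ->
  deriv_along X ricci_coef x = 2^-1 * exp13 x * (X x 0 0 + X x 0 2).
Proof.
move=> Mx; have s13 : smooth M (@exp13 R) := smooth_exp13 M_open.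
have sc (c : R) : smooth M (fun=> c) := smooth_cst M c.
rewrite (deriv_alongM _ (sc _) (smooth_add M_open (smooth_mul M_open (sc 2) s13) (sc 1)) Mx).
rewrite (deriv_alongD _ (smooth_mul M_open (sc 2) s13) (sc 1) Mx).
rewrite (deriv_alongM _ (sc 2) s13 Mx) !deriv_along_cst deriv_along_exp13.
by move: (X x) (exp13 x) => u F; field.
Qed.

Lemma deriv_along_weyl_coef X x : M x ->
  deriv_along X weyl_coef x = 4^-1 * exp13 x * (X x 0 0 + X x 0 2).
Proof.
move=> Mx; have s13 : smooth M (@exp13 R) := smooth_exp13 M_open.
have sc (c : R) : smooth M (fun=> c) := smooth_cst M c.
rewrite (deriv_alongM _ (sc _) (smooth_add M_open (smooth_mul M_open (sc 2) s13) (sc _)) Mx).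
rewrite (deriv_alongD _ (smooth_mul M_open (sc 2) s13) (sc _) Mx).
rewrite (deriv_alongM _ (sc 2) s13 Mx) !deriv_along_cst deriv_along_exp13.
by move: (X x) (exp13 x) => u F; field.
Qed.

Lemma cov2_ricci X X1 X2 x : smooth M X -> smooth M X1 -> smooth M X2 -> M x ->
  cov2 g (ricci g) X X1 X2 x =
  - (2^-1 * exp13 x * (X x 0 0 + X x 0 2)) * X1 x 0 0 * X2 x 0 0.
Proof.
move=> sX s1 s2 Mx; rewrite /cov2.
have sn V : smooth M V -> smooth M (nabla g X V) by exact: smooth_nabla.
rewrite (deriv_along_eq M_open X (fun y My => ricciE s1 s2 My) Mx) !ricciE//; try exact: sn.
have c (V : @vector_field R) k : smooth M V -> smooth M (fun y => V y 0 k) :=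
  fun sV => smooth_coord M_open k sV.
have sN := smooth_opp M_open smooth_ricci_coef.
rewrite (deriv_alongM _ (smooth_mul M_open sN (c _ _ s1)) (c _ _ s2) Mx).
rewrite (deriv_alongM _ sN (c _ _ s1) Mx) (deriv_alongN _ smooth_ricci_coef Mx).
rewrite (deriv_along_dx1 X s1 Mx) (deriv_along_dx1 X s2 Mx) deriv_along_ricci_coef//.
move: (X x) (X1 x) (X2 x) (nabla g X X1 x) (nabla g X X2 x) (ricci_coef x) (exp13 x).
by move=> u v w a b s F; ring.
Qed.

End CurvatureTensors.

(** * Recurrence 1-forms *)

Section Geometry.
Context {R : realType} (M : set 'rV[R]_4).
Context (M_open : open M).
Context (M_pos : forall x, M x -> forall i : 'I_4, 0 < x 0 i).
Implicit Types (X Y Z V : @vector_field R) (x : 'rV[R]_4) (p q a b : @scalar_field R).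
Local Notation g := (@the_metric R).

Local Opaque derive deriv_along nabla lie_bracket curvature_op.

Lemma exp13_gt1 x : M x -> 1 < exp13 x.
Proof. by move=> Mx; rewrite /exp13 expR_gt1 addr_gt0 ?M_pos. Qed.

Lemma ricci_coef_neq0 x : ricci_coef x != 0.
Proof.
have := expR_gt0 (x 0 0 + x 0 2); rewrite -/(exp13 x) /ricci_coef => F0.
by apply/lt0r_neq0; move: (exp13 x) F0 => F F0; lra.
Qed.

(** The coefficient would vanish for [F = 1/2]; positivity of the coordinates gives [F > 1]. *)
Lemma weyl_coef_neq0 x : M x -> weyl_coef x != 0.
Proof.
move=> /exp13_gt1; rewrite /weyl_coef => F1.
by apply/lt0r_neq0; move: (exp13 x) F1 => F F1; lra.
Qed.

Lemma riemann_wave : eq4 M M (riemann g) (pp_wave (fun x => 2^-1 * exp13 x) (fun=> 4^-1)).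
Proof.
move=> X1 X2 X3 X4 s1 s2 s3 s4 x Mx.
exact: (@riemannE R M M_open X1 X2 X3 X4 x s1 s2 s3 Mx).
Qed.

Lemma conharmonic_wave : eq4 M M (conharmonic g) weyl_wave.
Proof.
move=> X1 X2 X3 X4 s1 s2 s3 s4 x Mx.
exact: (@conharmonicE R M M_open X1 X2 X3 X4 x s1 s2 s3 s4 Mx).
Qed.

(** The 1-form [a (dx^1 + dx^3) + b dx^1]: the differential of a function of [F] is a
    multiple of [dx^1 + dx^3], and [dx^1] is the direction in which associated 1-forms can
    be shifted. *)
Definition form13 a b : @one_form R :=
  fun x => (a x + b x) *: delta_mx 0 0 + a x *: delta_mx 0 2.

Lemma ev_form a b X x : ev (form13 a b) X x = a x * (X x 0 0 + X x 0 2) + b x * X x 0 0.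
Proof.
rewrite /ev sum_ord4 /form13 !mxE !neq_ord4 !eqxx /=.
by move: (a x) (b x) (X x) => c d u; ring.
Qed.

Lemma smooth_form a b : smooth M a -> smooth M b -> smooth M (form13 a b).
Proof.
move=> sa sb n.
exact: Cn_add M_open (Cn_scale _ M_open (Cn_add M_open (sa n) (sb n)))
  (Cn_scale _ M_open (sa n)).
Qed.

Lemma smooth_sub (V : normedModType R) (U U' : set 'rV[R]_4) (f : 'rV[R]_4 -> V) :
  U' `<=` U -> smooth U f -> smooth U' f.
Proof. by move=> UU' sf n; exact: Cn_sub UU' (sf n). Qed.

Lemma nonzero2_sub (T : @tensor2 R) : nonzero2 M T `<=` M.
Proof. by move=> x []. Qed.

Lemma nonzero4_sub (T : @tensor4 R) : nonzero4 M T `<=` M.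
Proof. by move=> x []. Qed.

(** The factor by which [dx^1 + dx^3] is multiplied in [d(log ricci_coef)]. *)
Definition ricci_rate : @scalar_field R := fun x => 2^-1 * exp13 x * (ricci_coef x)^-1.
(** The factor by which [dx^1 + dx^3] is multiplied in [d(log weyl_coef)]. *)
Definition weyl_rate : @scalar_field R := fun x => 4^-1 * exp13 x * (weyl_coef x)^-1.

Lemma smooth_ricci_rate : smooth M ricci_rate.
Proof.
rewrite /ricci_rate; prove_smooth; apply: smooth_inv => //; last exact: smooth_ricci_coef.
by move=> x _; exact: ricci_coef_neq0.
Qed.

Lemma smooth_weyl_rate : smooth M weyl_rate.
Proof.
rewrite /weyl_rate; prove_smooth; apply: smooth_inv => //; last exact: smooth_weyl_coef.
exact: weyl_coef_neq0.
Qed.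

Lemma cov_ricci X X1 X2 x : smooth M X -> smooth M X1 -> smooth M X2 -> M x ->
  cov2 g (ricci g) X X1 X2 x = ev (form13 ricci_rate (fun=> 0)) X x * ricci g X1 X2 x.
Proof.
move=> sX s1 s2 Mx; rewrite (cov2_ricci M_open sX s1 s2 Mx) (ricciE M_open s1 s2 Mx) ev_form.
rewrite /ricci_rate; have := ricci_coef_neq0 x.
by move: (X x) (X1 x) (X2 x) (ricci_coef x) (exp13 x) => u v w s F s0; field.
Qed.

Lemma conformal_wave : eq4 M M (conformal g) weyl_wave.
Proof.
move=> X1 X2 X3 X4 s1 s2 s3 s4 x Mx.
by rewrite (@conformalE R M M_open X1 X2 X3 X4 x Mx) conharmonic_wave.
Qed.

Lemma cov_recurrent H X X1 X2 X3 X4 x :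
  eq4 M M H weyl_wave ->
  smooth M X -> smooth M X1 -> smooth M X2 -> smooth M X3 -> smooth M X4 -> M x ->
  cov4 g H X X1 X2 X3 X4 x = ev (form13 weyl_rate (fun=> 0)) X x * H X1 X2 X3 X4 x.
Proof.
move=> E sX s1 s2 s3 s4 Mx.
have sp := smooth_weyl_coef M_open; have sN := smooth_opp M_open sp.
rewrite (cov4_eq M_open E sX s1 s2 s3 s4 Mx) (E _ _ _ _ s1 s2 s3 s4 x Mx).
rewrite /weyl_wave (cov4_wave M_open sp sN sX s1 s2 s3 s4 Mx).
rewrite ev_form /pp_wave (deriv_alongN _ sp Mx).
rewrite (deriv_along_weyl_coef M_open _ Mx) /weyl_rate; have := weyl_coef_neq0 Mx.
move: (minor 2 X1 X2 x) (minor 3 X1 X2 x) (minor 2 X3 X4 x) (minor 3 X3 X4 x) => a b c d.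
by move: (X x) (weyl_coef x) (exp13 x) (exp1 x) => u s F h s0; field.
Qed.

(** The coefficient [1/4] of the other square is constant and drops out. *)
Lemma cov_riemann X X1 X2 X3 X4 x :
  smooth M X -> smooth M X1 -> smooth M X2 -> smooth M X3 -> smooth M X4 -> M x ->
  cov4 g (riemann g) X X1 X2 X3 X4 x =
  2^-1 * exp13 x * (X x 0 0 + X x 0 2) * minor 2 X1 X2 x * minor 2 X3 X4 x.
Proof.
move=> sX s1 s2 s3 s4 Mx.
have E := riemann_wave.
have s13 : smooth M (@exp13 R) := smooth_exp13 M_open.
have sc (c : R) : smooth M (fun=> c) := smooth_cst M c.
rewrite (cov4_eq M_open E sX s1 s2 s3 s4 Mx).
rewrite (cov4_wave M_open (smooth_mul M_open (sc _) s13) (sc _) sX s1 s2 s3 s4 Mx) /pp_wave.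
rewrite (deriv_alongM _ (sc _) s13 Mx) !deriv_along_cst deriv_along_exp13.
move: (minor 2 X1 X2 x) (minor 3 X1 X2 x) (minor 2 X3 X4 x) (minor 3 X3 X4 x) => a b c d.
by move: (X x) (exp13 x) (exp1 x) => u F h; ring.
Qed.

(** * Semisymmetry *)

(** The four factors [dx^1 ∧ dx^3], [dx^1 ∧ dx^4] of the two squares are killed separately
    by [minor_curvature_op]. *)
Lemma semisymmetric_wave T p q : eq4 M M T (pp_wave p q) -> semisymmetric4 M g T.
Proof.
move=> TE X1 X2 X3 X4 X Y s1 s2 s3 s4 sX sY x Mx.
rewrite /act4 !raise_riemann.
have sR Z : smooth M Z -> smooth M (curvature_op g X Y Z) by exact: smooth_curvature_op.
rewrite (TE _ _ _ _ (sR _ s1) s2 s3 s4 x Mx) (TE _ _ _ _ s1 (sR _ s2) s3 s4 x Mx).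
rewrite (TE _ _ _ _ s1 s2 (sR _ s3) s4 x Mx) (TE _ _ _ _ s1 s2 s3 (sR _ s4) x Mx) /pp_wave.
have mR i (i23 : (i == 2) || (i == 3)) Z V (sZ : smooth M Z) (sV : smooth M V) :=
  minor_curvature_op M_open sX sY sZ sV Mx i23.
rewrite (mR 2 isT _ _ s1 s2) (mR 3 isT _ _ s1 s2) (mR 2 isT _ _ s3 s4) (mR 3 isT _ _ s3 s4).
move: (p x) (q x) (exp1 x) (minor 2 X1 X2 x) (minor 3 X1 X2 x) (minor 2 X3 X4 x)
  (minor 3 X3 X4 x) (minor _ _ _ x) (minor _ _ _ x) (minor _ _ _ x) (minor _ _ _ x).
move=> *; ring.
Qed.

(** The values of [R(X, Y)] lie in the kernel of [dx^1]. *)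
Lemma ricci_curvature_op X Y Z V x :
  smooth M X -> smooth M Y -> smooth M Z -> smooth M V -> M x ->
  ricci g (curvature_op g X Y Z) V x = 0 /\ ricci g V (curvature_op g X Y Z) x = 0.
Proof.
move=> sX sY sZ sV Mx.
have sR : smooth M (curvature_op g X Y Z) by exact: smooth_curvature_op.
rewrite (ricciE M_open sR sV Mx) (ricciE M_open sV sR Mx).
by rewrite (curvature_op_0 M_open sX sY sZ Mx) !(mulr0, mul0r).
Qed.

Lemma semisymmetric_ricci : semisymmetric2 M g (ricci g).
Proof.
move=> X1 X2 X Y s1 s2 sX sY x Mx; rewrite /act2 !raise_riemann.
have [-> _] := ricci_curvature_op sX sY s1 s2 Mx.
by have [_ ->] := ricci_curvature_op sX sY s2 s1 Mx; rewrite addr0 oppr0.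
Qed.

Lemma semisymmetric_riemann : semisymmetric4 M g (riemann g).
Proof.
exact: semisymmetric_wave riemann_wave.
Qed.

(** The part of [P] beyond [R] is a combination of [g ⊗ S], and [R(X, Y)] is skew for [g]
    and kills [S]. *)
Lemma semisymmetric_projective : semisymmetric4 M g (projective g).
Proof.
move=> X1 X2 X3 X4 X Y s1 s2 s3 s4 sX sY x Mx.
have := semisymmetric_riemann s1 s2 s3 s4 sX sY Mx.
rewrite /act4 !raise_riemann /projective.
have S Z V (sZ : smooth M Z) (sV : smooth M V) := ricci_curvature_op sX sY sZ sV Mx.
rewrite (S _ _ s1 s3).1 (S _ _ s2 s3).1 (S _ _ s3 s2).2 (S _ _ s3 s1).2.
have mR Z V (sZ : smooth M Z) (sV : smooth M V) := metric_curvature_op M_open sX sY sZ sV Mx.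
rewrite (mR _ _ s1 s4) (mR _ _ s2 s4).
move: (riemann g _ X2 X3 X4 x) (riemann g X1 _ X3 X4 x) (riemann g X1 X2 _ X4 x)
  (riemann g X1 X2 X3 _ x) => a b c d.
move: (metric g X1 _ x) (metric g X2 _ x) (metric g X1 X4 x) (metric g X2 X4 x)
  (ricci g X2 X3 x) (ricci g X1 X3 x) => e f h i j k E.
rewrite -[RHS]E; ring.
Qed.

(** * The projective tensor acting on itself *)

Lemma projectiveE X1 X2 X3 X4 x :
  smooth M X1 -> smooth M X2 -> smooth M X3 -> M x ->
  projective g X1 X2 X3 X4 x =
  pp_wave (fun x => 2^-1 * exp13 x) (fun=> 4^-1) X1 X2 X3 X4 x
  + 3^-1 * ricci_coef x *
    (metric g X1 X4 x * X2 x 0 0 - metric g X2 X4 x * X1 x 0 0) * X3 x 0 0.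
Proof.
move=> s1 s2 s3 Mx; rewrite /projective (@riemannE R M M_open X1 X2 X3 X4 x s1 s2 s3 Mx).
rewrite (ricciE M_open s2 s3 Mx) (ricciE M_open s1 s3 Mx).
rewrite (_ : (4 : R) - 1 = 3); last by ring.
move: (pp_wave _ _ _ _ _ _ x) (metric g X1 X4 x) (metric g X2 X4 x) (X1 x) (X2 x) (X3 x)
  (ricci_coef x) => w a b u v t s.
by field.
Qed.

Section Linear.
Context (X1 X2 X3 X4 Y Z : @vector_field R) (c : R) (x : 'rV[R]_4).
Context (s1 : smooth M X1) (s2 : smooth M X2) (s3 : smooth M X3)
  (s4 : smooth M X4) (sY : smooth M Y) (sZ : smooth M Z) (Mx : M x).
Let U : @vector_field R := fun y => Y y - c *: Z y.

Lemma smooth_subZ : smooth M U.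
Proof.
apply: smooth_vector => // k.
have sE : smooth M (fun y => Y y 0 k + - (c * Z y 0 k)).
  exact: (smooth_add M_open (smooth_coord M_open k sY)
    (smooth_opp M_open (smooth_mul M_open (smooth_cst M c) (smooth_coord M_open k sZ)))).
by apply: (smooth_eq M_open _ sE) => y _; rewrite /U; move: (Y y) (Z y) => u v; rewrite !mxE.
Qed.
Let sU := smooth_subZ.

(** The linearity of [P] in its slots, for the combinations [R(X, Y) X_i - 1/3 (X ∧_S Y) X_i]
    that [P] produces when it acts. *)
Lemma projective_linear1 : projective g U X2 X3 X4 x =
  projective g Y X2 X3 X4 x - c * projective g Z X2 X3 X4 x.
Proof.
rewrite !projectiveE// /pp_wave /minor !metricE /U.
move: (Y x) (Z x) (X2 x) (X3 x) (X4 x) (exp13 x) (exp1 x) (ricci_coef x) => y z u v w F h s.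
by rewrite !mxE; field.
Qed.

Lemma projective_linear2 : projective g X1 U X3 X4 x =
  projective g X1 Y X3 X4 x - c * projective g X1 Z X3 X4 x.
Proof.
rewrite !projectiveE// /pp_wave /minor !metricE /U.
move: (Y x) (Z x) (X1 x) (X3 x) (X4 x) (exp13 x) (exp1 x) (ricci_coef x) => y z u v w F h s.
by rewrite !mxE; field.
Qed.

Lemma projective_linear3 : projective g X1 X2 U X4 x =
  projective g X1 X2 Y X4 x - c * projective g X1 X2 Z X4 x.
Proof.
rewrite !projectiveE// /pp_wave /minor !metricE /U.
move: (Y x) (Z x) (X1 x) (X2 x) (X4 x) (exp13 x) (exp1 x) (ricci_coef x) => y z u v w F h s.
by rewrite !mxE; field.
Qed.

Lemma projective_linear4 : projective g X1 X2 X3 U x =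
  projective g X1 X2 X3 Y x - c * projective g X1 X2 X3 Z x.
Proof.
rewrite !projectiveE// /pp_wave /minor !metricE /U.
move: (Y x) (Z x) (X1 x) (X2 x) (X3 x) (exp13 x) (exp1 x) (ricci_coef x) => y z u v w F h s.
by rewrite !mxE; field.
Qed.

End Linear.

(** By [raise_projective], [P·P] splits as [R·P], which is zero, and [- 1/3 Q(S, P)]. *)
Lemma projective_projective : eq6 M M (act4 g (projective g) (projective g))
  (fun X1 X2 X3 X4 X Y x =>
     - 3^-1 * tachibana (ricci g) (projective g) X1 X2 X3 X4 X Y x).
Proof.
move=> X1 X2 X3 X4 X Y s1 s2 s3 s4 sX sY x Mx.
have := semisymmetric_projective s1 s2 s3 s4 sX sY Mx.
rewrite /act4 /tachibana !raise_riemann !raise_projective.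
have sR Z : smooth M Z -> smooth M (curvature_op g X Y Z) by exact: smooth_curvature_op.
have sW Z : smooth M Z -> smooth M (wedge_op (ricci g) X Y Z) by exact: smooth_wedge_ricci.
rewrite (projective_linear1 _ 3^-1 s2 s3 (sR _ s1) (sW _ s1) Mx).
rewrite (projective_linear2 _ 3^-1 s1 s3 (sR _ s2) (sW _ s2) Mx).
rewrite (projective_linear3 _ 3^-1 s1 s2 (sR _ s3) (sW _ s3) Mx).
rewrite (projective_linear4 _ _ 3^-1 s1 s2 s3 Mx).
move: (projective g (curvature_op _ _ _ _) _ _ _ x) (projective g _ (curvature_op _ _ _ _) _ _ x)
  (projective g _ _ (curvature_op _ _ _ _) _ x) (projective g _ _ _ (curvature_op _ _ _ _) x)
  => a b c d.
move: (projective g (wedge_op _ _ _ _) _ _ _ x) (projective g _ (wedge_op _ _ _ _) _ _ x)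
  (projective g _ _ (wedge_op _ _ _ _) _ x) (projective g _ _ _ (wedge_op _ _ _ _) x)
  => a' b' c' d' E.
by rewrite -[RHS]add0r -E; ring.
Qed.

(** * Recurrent and weakly symmetric structures *)

Lemma nonzero2_ricci x : M x -> nonzero2 M (ricci g) x.
Proof.
move=> Mx; split=> //; exists (frame 0), (frame 0).
have sf i : smooth M (frame i : @vector_field R) by exact: smooth_frame.
split=> //; rewrite (ricciE M_open (sf 0) (sf 0) Mx) !frameE eqxx !mulr1 oppr_eq0.
exact: ricci_coef_neq0.
Qed.

Lemma nonzero4_wave H x : eq4 M M H weyl_wave -> M x ->
  nonzero4 M H x.
Proof.
move=> E Mx; split=> //; exists (frame 0), (frame 2), (frame 0), (frame 2).
have sf i : smooth M (frame i : @vector_field R) by exact: smooth_frame.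
split=> //; rewrite (E _ _ _ _ (sf 0) (sf 2) (sf 0) (sf 2) x Mx) /weyl_wave /pp_wave /minor !frameE.
rewrite !eqxx !neq_ord4 /= !(mulr0, mul0r, mulr1, subr0, addr0).
exact: weyl_coef_neq0.
Qed.

Lemma form_neq_fst (U : set 'rV[R]_4) a a' b b' x :
  U x -> a x != a' x -> form_neq U (form13 a b) (form13 a' b').
Proof.
move=> Ux aa'; exists x => //; apply: contra_neq aa' => /(congr1 (fun u : 'rV[R]_4 => u 0 2)).
by rewrite /form13 !mxE !neq_ord4 !eqxx /= !(mulr0, add0r, mulr1).
Qed.

Lemma form_neq_snd (U : set 'rV[R]_4) a b b' x :
  U x -> b x != b' x -> form_neq U (form13 a b) (form13 a b').
Proof.
move=> Ux bb'; exists x => //; apply: contra_neq bb' => /(congr1 (fun u : 'rV[R]_4 => u 0 0)).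
rewrite /form13 !mxE !neq_ord4 !eqxx /= !(mulr0, addr0, mulr1).
exact: addrI.
Qed.

Lemma ricci_rate_neq0 x : ricci_rate x != 0.
Proof.
rewrite /ricci_rate !mulf_neq0 ?invr_eq0 ?ricci_coef_neq0 ?pnatr_eq0//.
exact: lt0r_neq0 (expR_gt0 _).
Qed.

Lemma weyl_rate_neq0 x : M x -> weyl_rate x != 0.
Proof.
move=> Mx; rewrite /weyl_rate !mulf_neq0 ?invr_eq0 ?weyl_coef_neq0 ?pnatr_eq0//.
exact: lt0r_neq0 (expR_gt0 _).
Qed.

Definition dx1 (b : R) : @one_form R := form13 (fun=> 0) (fun=> b).

Lemma ev_dx1 (b : R) X x : ev (dx1 b) X x = b * X x 0 0.
Proof. by rewrite ev_form mul0r add0r. Qed.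

Lemma smooth_dx1 (b : R) : smooth M (dx1 b).
Proof. by apply: smooth_form; exact: smooth_cst. Qed.

(** Since [S] is a multiple of [dx^1 ⊗ dx^1], exchanging [X] with [X1] or [X2] in
    [dx^1(X) S(X1, X2)] changes nothing, so [b] and [d] are arbitrary. *)
Lemma weakly_ricci_symmetric_dx1 (b d : R) : weakly_ricci_symmetric_with M g
  (form13 ricci_rate (fun=> - (b + d))) (dx1 b) (dx1 d).
Proof.
have sA : smooth M (form13 ricci_rate (fun=> - (b + d))).
  by apply: smooth_form; [exact: smooth_ricci_rate|exact: smooth_cst].
split; try (apply: smooth_sub; first exact: nonzero2_sub); try exact: smooth_dx1.
  exact: sA.
move=> X sX X1 X2 s1 s2 x /nonzero2_sub Mx.
rewrite (cov_ricci sX s1 s2 Mx) !ev_form.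
rewrite (ricciE M_open s1 s2 Mx) (ricciE M_open sX s2 Mx) (ricciE M_open s1 sX Mx).
by move: (X x) (X1 x) (X2 x) (ricci_coef x) (ricci_rate x) => u v w s a; ring.
Qed.

(** The 2-forms [m = dx^1 ∧ dx^i] of which [H] is made satisfy
    [dx^1(X1) m(X, X2) + dx^1(X2) m(X1, X) = dx^1(X) m(X1, X2)], because [dx^1] divides
    them; so [b] and [d] are arbitrary. *)
Lemma weakly_symmetric_dx1 H (b d : R) : eq4 M M H weyl_wave ->
  weakly_symmetric_with M g H (form13 weyl_rate (fun=> - (b + d)))
    (dx1 b) (dx1 b) (dx1 d) (dx1 d).
Proof.
move=> E.
have sA : smooth M (form13 weyl_rate (fun=> - (b + d))).
  by apply: smooth_form; [exact: smooth_weyl_rate|exact: smooth_cst].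
have sd c : smooth (nonzero4 M H) (dx1 c).
  by apply: smooth_sub (smooth_dx1 c); exact: nonzero4_sub.
split=> //; first by apply: smooth_sub sA; exact: nonzero4_sub.
split=> // X sX X1 X2 X3 X4 s1 s2 s3 s4 x /nonzero4_sub Mx.
rewrite (cov_recurrent E sX s1 s2 s3 s4 Mx) !ev_form.
rewrite (E _ _ _ _ s1 s2 s3 s4 x Mx) (E _ _ _ _ sX s2 s3 s4 x Mx) (E _ _ _ _ s1 sX s3 s4 x Mx).
rewrite (E _ _ _ _ s1 s2 sX s4 x Mx) (E _ _ _ _ s1 s2 s3 sX x Mx).
rewrite /weyl_wave /pp_wave /minor.
move: (X x) (X1 x) (X2 x) (X3 x) (X4 x) (weyl_coef x) (weyl_rate x) (exp1 x) => u v w y z s a h.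
by ring.
Qed.

Lemma recurrent4_wave H : eq4 M M H weyl_wave -> recurrent4 M g H.
Proof.
move=> E; exists (form13 weyl_rate (fun=> 0)); split.
  apply: smooth_sub; first exact: nonzero4_sub.
  by apply: smooth_form; [exact: smooth_weyl_rate|exact: smooth_cst].
move=> X sX X1 X2 X3 X4 s1 s2 s3 s4 x /nonzero4_sub Mx.
exact: cov_recurrent.
Qed.

Lemma recurrent_two_forms_wave H : eq4 M M H weyl_wave ->
  recurrent_curvature_two_forms M g H.
Proof.
move=> E; exists (form13 weyl_rate (fun=> 0)); split.
  by apply: smooth_form; [exact: smooth_weyl_rate|exact: smooth_cst].
by move=> X1 X2 X3 X Y s1 s2 s3 sX sY x Mx; rewrite !(cov_recurrent E).
Qed.

(** The second Bianchi identity, here in the form [(dx^1 + dx^3) ∧ dx^1 ∧ dx^3 = 0]: the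
    zero 1-form serves. *)
Lemma recurrent_two_forms_riemann : recurrent_curvature_two_forms M g (riemann g).
Proof.
exists (dx1 0); split; first exact: smooth_dx1.
move=> X1 X2 X3 X Y s1 s2 s3 sX sY x Mx.
rewrite (cov_riemann s1 s2 s3 sX sY Mx) (cov_riemann s2 s3 s1 sX sY Mx).
rewrite (cov_riemann s3 s1 s2 sX sY Mx) !ev_dx1 !mul0r !addr0.
rewrite ![minor 2 _ _ x]/minor.
by move: (X1 x) (X2 x) (X3 x) (X x) (Y x) (exp13 x) => u v w y z F; ring.
Qed.

Lemma ricci_recurrent_metric : ricci_recurrent M g.
Proof.
exists (form13 ricci_rate (fun=> 0)); split.
  apply: smooth_sub; first exact: nonzero2_sub.
  by apply: smooth_form; [exact: smooth_ricci_rate|exact: smooth_cst].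
by move=> X sX X1 X2 s1 s2 x /nonzero2_sub Mx; exact: cov_ricci.
Qed.

Lemma generalized_ricci_recurrent_metric : generalized_ricci_recurrent M g.
Proof.
have [A [sA rA]] := ricci_recurrent_metric.
exists A, (dx1 0); split=> //.
  by apply: smooth_sub (smooth_dx1 0); exact: nonzero2_sub.
move=> X sX X1 X2 s1 s2 x Ux.
by rewrite (rA X sX X1 X2 s1 s2 x Ux) ev_dx1 !mul0r addr0.
Qed.

Lemma recurrent_ricci_one_forms_metric : recurrent_ricci_one_forms M g.
Proof.
exists (form13 ricci_rate (fun=> 0)); split.
  by apply: smooth_form; [exact: smooth_ricci_rate|exact: smooth_cst].
by move=> X1 X2 X s1 s2 sX x Mx; rewrite !cov_ricci.
Qed.

(** Comparing the coefficients of the two squares, with [a] and [b] the factors of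
    [dx^1 + dx^3], leads to [a F/2 + b ricci_coef = F/2] and [a/4 + b ricci_coef = 0]; the
    difference of the two equations is solved by [a = weyl_rate]. *)
Lemma hyper_generalized_recurrent_metric : hyper_generalized_recurrent M g.
Proof.
have sub : nonzero4 M (riemann g) `&`
    nonzero4 M (kulkarni_nomizu (metric g) (ricci g)) `<=` M by move=> x [[]].
have sB : smooth M (fun x => - (weyl_rate x * 4^-1 * (ricci_coef x)^-1)).
  have sK := smooth_weyl_rate; prove_smooth; apply: smooth_inv => //; last exact: smooth_ricci_coef.
  by move=> x _; exact: ricci_coef_neq0.
(* [b] is [- a/4] divided by [ricci_coef], from the second equation. *)
exists (form13 weyl_rate (fun=> 0)),
  (form13 (fun x => - (weyl_rate x * 4^-1 * (ricci_coef x)^-1)) (fun=> 0)); split.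
- apply: smooth_sub sub _.
  by apply: smooth_form; [exact: smooth_weyl_rate|exact: smooth_cst].
- apply: smooth_sub sub _; apply: smooth_form => //; exact: smooth_cst.
move=> X sX X1 X2 X3 X4 s1 s2 s3 s4 x /sub Mx.
rewrite (cov_riemann sX s1 s2 s3 s4 Mx) (riemann_wave s1 s2 s3 s4 Mx) kulkarni_nomizuC.
rewrite (@kulkarni_nomizuE R M M_open X1 X2 X3 X4 x s1 s2 s3 s4 Mx) !ev_form /pp_wave.
rewrite /weyl_rate; have := weyl_coef_neq0 Mx; have := ricci_coef_neq0 x.
rewrite /weyl_coef /ricci_coef.
move: (minor 2 X1 X2 x) (minor 3 X1 X2 x) (minor 2 X3 X4 x) (minor 3 X3 X4 x) => a b c d.
move: (X x) (exp13 x) (exp1 x) => u F h s0 p0.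
have s0' : 2 * F + 1 != 0 by apply: contraNneq s0 => ->; rewrite mulr0.
have p0' : 2 * F - 1 != 0 by apply: contraNneq p0 => ->; rewrite mulr0.
by field; rewrite s0' p0'.
Qed.

Lemma ricci_simple_metric : ricci_simple M g.
Proof.
exists (fun x => - ricci_coef x), (dx1 1); split; last first.
- move=> X1 X2 s1 s2 x Mx; rewrite (ricciE M_open s1 s2 Mx) !ev_dx1 !mul1r.
  by rewrite mulrA.
- exact: smooth_dx1.
- by have sN := smooth_opp M_open (smooth_ricci_coef M_open); exact sN.
Qed.

End Geometry.

Theorem proposition3p1 (R : realType) (M : set 'rV[R]_4)
  (M_open : open M) (M_connected : connected M) (M_nonempty : M !=set0)
  (M_pos : forall x, M x -> forall i : 'I_4, 0 < x 0 i) :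
  let g := @the_metric R in
  let S := ricci g in
  let C := conformal g in
  let P := projective g in
  let W := concircular g in
  let K := conharmonic g in
  let US := nonzero2 M S in
  let UK := nonzero4 M K in
  (* (i) *)
  ricci_simple M g
  /\
  (* (ii) *)
  constant_scalar_curvature M g
  /\
  (* (iii) *)
  [/\ ricci_recurrent M g,
      weakly_ricci_symmetric M g
    & recurrent_ricci_one_forms M g]
  /\
  (* (iv) *)
  [/\ conharmonically_recurrent M g,
      conformally_recurrent M g,
      conharmonically_weakly_symmetric M g,
      conformally_weakly_symmetric M g
    & recurrent_curvature_two_forms M g C
      /\ recurrent_curvature_two_forms M g K]
  /\
  (* (v) *)
  (hyper_generalized_recurrent M g /\ generalized_ricci_recurrent M g)
  /\
  (* (vi) *)
  (semisymmetric4 M g (riemann g)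
   /\ [/\ semisymmetric2 M g S, semisymmetric4 M g C, semisymmetric4 M g P,
          semisymmetric4 M g W & semisymmetric4 M g K])
  /\
  (* (vii) *)
  ((exists A B D : one_form,
      weakly_ricci_symmetric_with M g A B D
      /\ [/\ form_neq US A B, form_neq US A D & form_neq US B D])
   /\
   (exists A B B' D D' : one_form,
      weakly_symmetric_with M g K A B B' D D'
      /\ [/\ form_neq UK A B, form_neq UK A B', form_neq UK A D
           & form_neq UK A D']
      /\ [/\ form_neq UK B D, form_neq UK B D', form_neq UK B' D
           & form_neq UK B' D'])
   /\
   (exists A B D A1 B1 D1 : one_form,
      [/\ weakly_ricci_symmetric_with M g A B D,
          weakly_ricci_symmetric_with M g A1 B1 D1
        & form_neq US A A1 \/ form_neq US B B1 \/ form_neq US D D1])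
   /\
   (exists A B B' D D' A1 B1 B1' D1 D1' : one_form,
      [/\ weakly_symmetric_with M g K A B B' D D',
          weakly_symmetric_with M g K A1 B1 B1' D1 D1'
        & [\/ form_neq UK A A1, form_neq UK B B1, form_neq UK B' B1'
            | form_neq UK D D1 \/ form_neq UK D' D1']]))
  /\
  (* (viii) *)
  recurrent_curvature_two_forms M g (riemann g)
  /\
  (* (ix) *)
  (eq6 M M (act4 g P P)
     (fun X1 X2 X3 X4 X Y x => - 3^-1 * tachibana S P X1 X2 X3 X4 X Y x)
   /\ ricci_generalized_pseudosymmetric_projective M g).
Proof.
move=> g S C P W K US UK.
have KE : eq4 M M K weyl_wave := conharmonic_wave M_open.
have CE : eq4 M M C weyl_wave := conformal_wave M_open.
have RE := riemann_wave M_open.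
have WE : eq4 M M W (pp_wave (fun x => 2^-1 * exp13 x) (fun=> 4^-1)).
  move=> X1 X2 X3 X4 s1 s2 s3 s4 x Mx.
  by rewrite -RE// /W (@concircularE R M M_open X1 X2 X3 X4 x Mx).
have wR (b d : R) := weakly_ricci_symmetric_dx1 M_open b d.
have wK (b d : R) := weakly_symmetric_dx1 M_open M_pos b d KE.
have wC (b d : R) := weakly_symmetric_dx1 M_open M_pos b d CE.
have [x0 Mx0] := M_nonempty.
have USx0 : US x0 := nonzero2_ricci M_open Mx0.
have UKx0 : UK x0 := nonzero4_wave M_pos KE Mx0.
have aS a b (c : R) : form_neq US (form13 (@ricci_rate R) a) (dx1 c).
  exact: form_neq_fst USx0 (ricci_rate_neq0 x0).
have aK a (c : R) : form_neq UK (form13 (@weyl_rate R) a) (dx1 c).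
  exact: form_neq_fst UKx0 (weyl_rate_neq0 M_pos Mx0).
have neq12 : (1 : R) != 2 by rewrite lt_eqF ?ltr1n.
have dS : form_neq US (dx1 (1 : R)) (dx1 2) by exact: form_neq_snd USx0 neq12.
have dK : form_neq UK (dx1 (1 : R)) (dx1 2) by exact: form_neq_snd UKx0 neq12.
split; first exact: ricci_simple_metric.
split; first by exists 0 => x Mx; exact: scalE Mx.
split.
  split; first exact: ricci_recurrent_metric.
    by do 3 eexists; exact: wR 0 0.
  exact: recurrent_ricci_one_forms_metric.
split.
  split; [exact: recurrent4_wave|exact: recurrent4_wave| | |].
  - by do 5 eexists; exact: wK 0 0.
  - by do 5 eexists; exact: wC 0 0.
  - by split; exact: recurrent_two_forms_wave.
split.
  split; first exact: hyper_generalized_recurrent_metric.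
  exact: generalized_ricci_recurrent_metric.
split.
  split; first exact: semisymmetric_riemann.
  split; [exact: semisymmetric_ricci|exact: semisymmetric_wave CE
    |exact: semisymmetric_projective|exact: semisymmetric_wave WE
    |exact: semisymmetric_wave KE].
split.
  split; first by do 3 eexists; split; [exact: wR 1 2|split=> //; exact: aS].
  split.
    do 5 eexists; split; first exact: wK 1 2.
    by split; split=> //; exact: aK.
  split.
    do 6 eexists; split; [exact: wR 1 2|exact: wR 2 1|].
    by right; left.
  do 10 eexists; split; [exact: wK 1 2|exact: wK 2 1|].
  exact: Or42 dK.
split; first exact: recurrent_two_forms_riemann.
split; first exact: projective_projective.
exists (fun=> - 3^-1); split; first exact: (smooth_cst _ (- 3^-1)).
move=> X1 X2 X3 X4 X Y s1 s2 s3 s4 sX sY x [Mx _].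
exact: (projective_projective M_open s1 s2 s3 s4 sX sY Mx).
Qed.
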